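(* Let $C_l = 0.0000035462$ and $C_r = 0.0000021511$. There exist functions $r_1, r_2 : [e,\infty)\to\mathbb{R}$ with $r_1(x) = o\!\left(\frac{1}{\sqrt{\ln(x)}}\right)$ and $r_2(x) = o\!\left(\frac{1}{\sqrt{\ln(x)}}\right)$ as $x\to\infty$ such that $$\frac{1}{3}\sqrt{\frac{2\pi}{\ln(x)}} + r_1(x) \le \varepsilon(x) \le \frac{1}{3}\sqrt{\frac{2\pi}{\ln(x)}} + r_2(x) \qquad \text{for all } e \le x \le e^{1000},$$ and $$\frac{1}{3}\sqrt{\frac{2\pi}{\ln(x)}} + r_1(x) - C_l \le \varepsilon(x) \le \frac{1}{3}\sqrt{\frac{2\pi}{\ln(x)}} + r_2(x) + C_r \qquad \text{for all } x > e^{1000}.$$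
   Context: For $x>1$, $\operatorname{li}(x)=\int_0^x \frac{dt}{\ln(t)}$ denotes the logarithmic integral (with the integral across the singularity $t=1$ understood as a Cauchy principal value). For real $x\ge e$, the Stieltjes approximation of $\operatorname{li}(x)$ is $$\operatorname{li}_{*}(x) = \frac{(\ln(x)-n^{*})\,x\,n^{*}!}{\ln^{n^{*}+1}(x)} + \frac{x}{\ln(x)} \sum_{k=0}^{n^{*}-1} \frac{k!}{\ln^{k}(x)}, \qquad n^{*}=\lfloor \ln(x)\rfloor,$$ where $\ln^m(x)$ means $(\ln x)^m$. The Stieltjes approximation error is $\varepsilon(x)=\operatorname{li}_{*}(x)-\operatorname{li}(x)$ for $x\ge e$. *)

(* Defs.v *)
From Stdlib Require Import Reals ZArith Zfloor.
From Coquelicot Require Import Coquelicot.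
Open Scope R_scope.

(* li x = PV int_0^x dt / ln t for x > 1: a symmetric interval of radius d
   around the singularity t = 1 is removed and d -> 0+.  The endpoint t = 0
   is harmless: 1 / ln t tends to 0 there, and the library's conventions
   ln 0 = 0 and / 0 = 0 extend the integrand by that value.  As for
   Coquelicot's RInt, iota selects the unique limit. *)
Definition li (x : R) : R :=
  iota (fun l : R =>
    filterlim
      (fun d : R => RInt (fun t => / ln t) 0 (1 - d)
                    + RInt (fun t => / ln t) (1 + d) x)
      (at_right 0) (locally l)).

Definition nstar (x : R) : nat := Z.to_nat (Zfloor (ln x)).

(* For x >= e one has nstar x >= 1, so sum_f_R0 _ (nstar x - 1) is the sum
   over 0 <= k <= nstar x - 1. *)
Definition li_star (x : R) : R :=
  (ln x - INR (nstar x)) * x * INR (fact (nstar x)) / ln x ^ (nstar x + 1)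
  + x / ln x
    * sum_f_R0 (fun k => INR (fact k) / ln x ^ k) (nstar x - 1).

Definition stieltjes_error (x : R) : R := li_star x - li x.

(* g = o(f) at +oo; Coquelicot's is_domin takes the dominating function
   first. *)
Definition little_o_infty (g f : R -> R) : Prop :=
  is_domin (Rbar_locally p_infty) f g.

Definition main_term (x : R) : R := 1 / 3 * sqrt (2 * PI / ln x).

(* Main.v *)
Require Import Defs.
From Stdlib Require Import Reals ZArith Zfloor Lra Lia.
From Coquelicot Require Import Coquelicot.
Open Scope R_scope.

(** In fact [stieltjes_error x = main_term x + o(1 / sqrt (ln x))], so one function serves as both
    [r1] and [r2].  Write [y = ln x] and [n = nstar x].  The sum defining [li_star] telescopes under
    differentiation: the error is continuous in [y] and on [[n, n + 1]] its derivative is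
    [- n! e^y y^(-n-2) (y - n) (n + 1 - y)].  Hence it is decreasing, and Stirling's formula gives
    [eps(n) - eps(n + 1) ~ sqrt (2 PI) / 6 * n^(-3/2)].  Summing from infinity yields
    [eps(n) ~ sqrt (2 PI) / (3 sqrt n)], provided that [eps(n) -> 0].  For this last point,
    repeated integration by parts and the substitution [t = e^u] give
    [eps(n) = int_0^n (p(u) - q(u)) / u du + int_n^oo p(u) / u du] with
    [p(u) = (1 + u/n)^n e^(-u)] and [q(u) = (1 - u/n)^n e^u], and [p - q] is nonnegative and
    [O(u^3 / n^2)] times a Gaussian of width [sqrt n]. *)

(** * The principal value integral and the derivative of [li] *)

(** Step estimates fix the error only up to an additive constant, which no local computation with
    [li] can see; hence the separate proof that the error tends to 0 along the integers, where the
    behaviour of [li] across [t = 1] matters. Improper integrals are avoided: each is represented by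
    a function with the right derivative and a normalisation ([below_one] decays at infinity,
    [above_one] vanishes at [c]), so that inequalities between integrals become monotonicity of
    auxiliary functions. The excision in [li] is symmetric in [t] but not in [u = ln t], so the two
    sides stop at slightly different distances from the singularity, and this mismatch must be shown
    to vanish. Summation from infinity is also replaced by monotonicity: the error at [n] minus a
    suitable multiple of $1/\sqrt n$ is eventually monotone with limit 0, hence of fixed sign. The
    factor $1/6$ is $\int_0^1 s(1-s)\,ds$; as $n^{-1/2}$ drops by about $n^{-3/2}/2$ per step,
    $\sqrt{2\pi}/6$ turns into $\sqrt{2\pi}/3$. *)

Lemma is_derive_eq (f : R -> R) (x l l' : R) : is_derive f x l -> l = l' -> is_derive f x l'.
Proof. now intros h <-. Qed.

Lemma is_derive_Rplus (f g : R -> R) (x a b : R) :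
  is_derive f x a -> is_derive g x b -> is_derive (fun t => f t + g t) x (a + b).
Proof. apply (@is_derive_plus R_AbsRing R_NormedModule). Qed.

Lemma is_derive_Rcomp (f g : R -> R) (x a b : R) :
  is_derive f (g x) a -> is_derive g x b -> is_derive (fun t => f (g t)) x (b * a).
Proof. apply (@is_derive_comp R_AbsRing R_NormedModule). Qed.

Lemma is_derive_continuity_pt (f : R -> R) (x l : R) :
  is_derive f x l -> continuity_pt f x.
Proof.
  intros h. apply derivable_continuous_pt. exists l. now apply is_derive_Reals.
Qed.

Lemma derive_nonneg_le (f df : R -> R) (a b : R) :
  a <= b ->
  (forall x, a <= x <= b -> is_derive f x (df x)) ->
  (forall x, a <= x <= b -> 0 <= df x) ->
  f a <= f b.
Proof.
  intros hab hd hp.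
  destruct (MVT_gen f a b df) as [c [hc heq]].
  - rewrite Rmin_left, Rmax_right by lra. intros x hx. apply hd; lra.
  - rewrite Rmin_left, Rmax_right by lra. intros x hx.
    apply (is_derive_continuity_pt _ _ (df x)). apply hd; lra.
  - rewrite Rmin_left, Rmax_right in hc by lra.
    assert (0 <= df c * (b - a)) by (apply Rmult_le_pos; [apply hp|]; lra).
    lra.
Qed.

Lemma derive_nonpos_ge (f df : R -> R) (a b : R) :
  a <= b ->
  (forall x, a <= x <= b -> is_derive f x (df x)) ->
  (forall x, a <= x <= b -> df x <= 0) ->
  f b <= f a.
Proof.
  intros hab hd hp.
  enough (- f a <= - f b) by lra.
  apply (derive_nonneg_le (fun x => - f x) (fun x => - df x)); trivial.
  - intros x hx. apply (@is_derive_opp R_AbsRing R_NormedModule). now apply hd.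
  - intros x hx. specialize (hp x hx). lra.
Qed.

Lemma ln_le_sub_1 (t : R) : 0 < t -> ln t <= t - 1.
Proof.
  intros ht. rewrite <- (ln_exp (t - 1)); apply ln_le; trivial.
  pose proof (exp_ineq1_le (t - 1)). lra.
Qed.

Lemma ln_ge_1_sub_inv (t : R) : 0 < t -> 1 - / t <= ln t.
Proof.
  intros ht. pose proof (ln_le_sub_1 (/ t) (Rinv_0_lt_compat _ ht)) as h.
  rewrite ln_Rinv in h by trivial. lra.
Qed.

Lemma ln_pos (t : R) : 1 < t -> 0 < ln t.
Proof. intros. rewrite <- ln_1. apply ln_increasing; lra. Qed.

Lemma ln_neg (t : R) : 0 < t < 1 -> ln t < 0.
Proof. intros. rewrite <- ln_1. apply ln_increasing; lra. Qed.

Lemma ln_nonpos_eq (t : R) : t <= 0 -> ln t = 0.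
Proof. intros. unfold ln. destruct (Rlt_dec 0 t); [exfalso; lra | reflexivity]. Qed.

(** * Regularity of [/ ln t] away from [t = 1] *)

Lemma continuous_inv_ln (t : R) : 0 < t -> t <> 1 -> continuous (fun t => / ln t) t.
Proof.
  intros h0 h1. apply (@ex_derive_continuous R_AbsRing R_NormedModule).
  auto_derive. split; trivial. split; trivial.
  destruct (Rdichotomy _ _ h1).
  - pose proof (ln_neg t). lra.
  - pose proof (ln_pos t). lra.
Qed.

Lemma continuous_inv_ln_0 : continuous (fun t => / ln t) 0.
Proof.
  intros P [eps hP]. simpl in hP. rewrite (ln_nonpos_eq 0), Rinv_0 in hP by lra.
  (* For $0<t<e^{-1/\varepsilon}$ one has $\ln t<-1/\varepsilon$; for $t\le 0$ the integrand is 0 by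
     convention. *)
  exists (mkposreal _ (exp_pos (- / eps))). intros t ht.
  apply hP. change (Rabs (/ ln t - 0) < eps). change (Rabs (t - 0) < exp (- / eps)) in ht.
  rewrite Rminus_0_r in *. pose proof (cond_pos eps) as he.
  destruct (Rle_dec t 0) as [h|h].
  - rewrite ln_nonpos_eq, Rinv_0, Rabs_R0; trivial.
  - rewrite Rabs_pos_eq in ht by lra.
    assert (hl : ln t < - / eps) by (rewrite <- (ln_exp (- / eps)); apply ln_increasing; lra).
    assert (0 < / eps) by now apply Rinv_0_lt_compat.
    rewrite Rabs_inv, Rabs_left by lra.
    rewrite <- (Rinv_inv eps). apply Rinv_lt_contravar; [|lra].
    apply Rmult_lt_0_compat; lra.
Qed.

Lemma ex_RInt_inv_ln_lt1 (b : R) : 0 <= b < 1 -> ex_RInt (fun t => / ln t) 0 b.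
Proof.
  intros hb. apply (@ex_RInt_continuous R_CompleteNormedModule). intros z.
  rewrite Rmin_left, Rmax_right by lra. intros hz.
  destruct (Req_dec z 0) as [->|]; [apply continuous_inv_ln_0|].
  apply continuous_inv_ln; lra.
Qed.

Lemma ex_RInt_inv_ln_gt1 (a b : R) : 1 < a -> 1 < b -> ex_RInt (fun t => / ln t) a b.
Proof.
  intros ha hb. apply (@ex_RInt_continuous R_CompleteNormedModule). intros z [hz _].
  apply continuous_inv_ln; unfold Rmin in hz; destruct (Rle_dec a b); lra.
Qed.

Lemma is_derive_RInt_inv_ln_lt1 (t : R) :
  0 < t < 1 -> is_derive (fun b => RInt (fun t => / ln t) 0 b) t (/ ln t).
Proof.
  intros ht. apply (is_derive_RInt (fun t => / ln t) _ 0); [|apply continuous_inv_ln; lra].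
  apply (locally_interval _ t 0 1); simpl; try lra.
  intros y hy0 hy1. apply (@RInt_correct R_CompleteNormedModule). apply ex_RInt_inv_ln_lt1; lra.
Qed.

Lemma is_derive_RInt_inv_ln_gt1 (a t : R) :
  1 < a -> 1 < t -> is_derive (fun b => RInt (fun t => / ln t) a b) t (/ ln t).
Proof.
  intros ha ht. apply (is_derive_RInt (fun t => / ln t) _ a); [|apply continuous_inv_ln; lra].
  apply (locally_interval _ t 1 p_infty); simpl; try lra; trivial.
  intros y hy0 hy1. apply (@RInt_correct R_CompleteNormedModule). apply ex_RInt_inv_ln_gt1; lra.
Qed.

Lemma is_derive_RInt_inv_ln_gt1_lower (a t : R) :
  1 < a -> 1 < t -> is_derive (fun b => RInt (fun t => / ln t) b a) t (- / ln t).
Proof.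
  intros ha ht. apply (is_derive_RInt' (fun t => / ln t) _ t a); [|apply continuous_inv_ln; lra].
  apply (locally_interval _ t 1 p_infty); simpl; try lra; trivial.
  intros y hy0 hy1. apply (@RInt_correct R_CompleteNormedModule). apply ex_RInt_inv_ln_gt1; lra.
Qed.

Definition pv (x d : R) : R :=
  RInt (fun t => / ln t) 0 (1 - d) + RInt (fun t => / ln t) (1 + d) x.

(** The poles cancel: $1/\ln(1+d)$ lies in $[1/d, 1/d+1]$ and $-1/\ln(1-d)$ in $[1/d-1, 1/d]$. *)
Lemma inv_ln_symmetric_bound (d : R) :
  0 < d < 1 -> Rabs (- / ln (1 - d) - / ln (1 + d)) <= 2.
Proof.
  intros hd.
  assert (a1 := ln_le_sub_1 (1 + d) ltac:(lra)).
  assert (a2 := ln_ge_1_sub_inv (1 + d) ltac:(lra)).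
  assert (b1 := ln_le_sub_1 (1 - d) ltac:(lra)).
  assert (b2 := ln_ge_1_sub_inv (1 - d) ltac:(lra)).
  assert (ap := ln_pos (1 + d) ltac:(lra)).
  assert (bn := ln_neg (1 - d) ltac:(lra)).
  rewrite <- Rinv_opp.
  set (a := ln (1 + d)) in *. set (b := ln (1 - d)) in *.
  assert (e1 : 1 - / (1 + d) = d / (1 + d)) by (field; lra).
  assert (e2 : - (1 - / (1 - d)) = d / (1 - d)) by (field; lra).
  assert (h1 : / d <= / a) by (apply Rinv_le_contravar; lra).
  assert (h2 : / - b <= / d) by (apply Rinv_le_contravar; lra).
  assert (p1 : 0 < d / (1 + d)) by (apply Rdiv_lt_0_compat; lra).
  assert (h3 : / a <= / (d / (1 + d))) by (apply Rinv_le_contravar; lra).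
  assert (h4 : / (d / (1 - d)) <= / - b) by (apply Rinv_le_contravar; lra).
  replace (/ (d / (1 + d))) with (/ d + 1) in h3 by (field; lra).
  replace (/ (d / (1 - d))) with (/ d - 1) in h4 by (field; lra).
  apply Rabs_le. lra.
Qed.

Lemma is_derive_pv (x d : R) :
  1 < x -> 0 < d < 1 -> is_derive (pv x) d (- / ln (1 - d) - / ln (1 + d)).
Proof.
  intros hx hd. unfold pv. eapply is_derive_eq.
  - apply is_derive_Rplus.
    + apply (is_derive_Rcomp (fun b => RInt (fun t => / ln t) 0 b) (fun d => 1 - d)).
      * apply is_derive_RInt_inv_ln_lt1; lra.
      * auto_derive; trivial.
    + apply (is_derive_Rcomp (fun b => RInt (fun t => / ln t) b x) (fun d => 1 + d)).
      * apply is_derive_RInt_inv_ln_gt1_lower; lra.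
      * auto_derive; trivial.
  - simpl. ring.
Qed.

(** The bounded derivative in [d] yields the Cauchy criterion as $d\to 0^+$, hence existence of the
    principal value without computing it. *)
Lemma pv_lipschitz (x d d' : R) :
  1 < x -> 0 < d < 1 -> 0 < d' < 1 -> Rabs (pv x d' - pv x d) <= 2 * Rabs (d' - d).
Proof.
  intros hx hd hd'.
  assert (hb : forall z, Rmin d d' <= z <= Rmax d d' -> 0 < z < 1).
  { intros z. unfold Rmin, Rmax. destruct (Rle_dec d d'); lra. }
  destruct (MVT_gen (pv x) d d' (fun d => - / ln (1 - d) - / ln (1 + d))) as [c [hc ->]].
  - intros z hz. apply is_derive_pv; trivial. apply hb; lra.
  - intros z hz. eapply is_derive_continuity_pt, is_derive_pv; auto.
  - rewrite Rabs_mult. apply Rmult_le_compat_r; [apply Rabs_pos|].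
    apply inv_ln_symmetric_bound; auto.
Qed.

Lemma at_right_0_lt (e : R) : 0 < e -> at_right 0 (fun d => 0 < d < e).
Proof.
  intros he. exists (mkposreal e he). intros y hy hy0.
  change (Rabs (y - 0) < e) in hy. rewrite Rminus_0_r, Rabs_pos_eq in hy; lra.
Qed.

Lemma ex_lim_pv (x : R) :
  1 < x -> exists l : R, filterlim (pv x) (at_right 0) (locally l).
Proof.
  intros hx. apply (proj1 (filterlim_locally_cauchy (U := R_CompleteSpace) (pv x))).
  intros eps. pose proof (cond_pos eps) as he.
  exists (fun d => 0 < d < Rmin 1 (eps / 2)). split.
  - apply at_right_0_lt. apply Rmin_glb_lt; lra.
  - intros u v hu hv.
    pose proof (Rmin_l 1 (eps / 2)). pose proof (Rmin_r 1 (eps / 2)).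
    change (Rabs (pv x v - pv x u) < eps).
    eapply Rle_lt_trans; [apply pv_lipschitz; lra|].
    assert (Rabs (v - u) < eps / 2) by (apply Rabs_def1; lra). lra.
Qed.

(** [iota] returns the limit once existence and uniqueness are known; all later facts about [li]
    pass through this statement. *)
Lemma lim_pv_li (x : R) : 1 < x -> filterlim (pv x) (at_right 0) (locally (li x)).
Proof.
  intros hx. unfold li.
  apply (iota_correct (V := R_CompleteNormedModule)
           (fun l : R => filterlim (pv x) (at_right 0) (locally l))).
  destruct (ex_lim_pv x hx) as [l hl]. exists l. split; trivial.
  intros l' hl'. exact (@filterlim_locally_unique R R_AbsRing R_NormedModule _ _ _ l l' hl hl').
Qed.

Lemma li_Chasles (a b : R) :
  1 < a -> 1 < b -> li b = li a + RInt (fun t => / ln t) a b.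
Proof.
  intros ha hb.
  apply (@filterlim_locally_unique R R_AbsRing R_NormedModule (at_right 0) _ (pv b)).
  - now apply lim_pv_li.
  - apply (filterlim_ext_loc (fun d => pv a d + RInt (fun t => / ln t) a b)).
    + eapply filter_imp, (at_right_0_lt 1 Rlt_0_1). intros d hd. unfold pv.
      rewrite Rplus_assoc. f_equal.
      apply (@RInt_Chasles R_CompleteNormedModule); apply ex_RInt_inv_ln_gt1; lra.
    + eapply (filterlim_comp_2 (pv a) (fun _ => RInt (fun t => / ln t) a b) Rplus).
      * exact (lim_pv_li a ha).
      * apply (filterlim_const (RInt (fun t => / ln t) a b)).
      * apply (@filterlim_plus R_AbsRing R_NormedModule).
Qed.

Lemma is_derive_li (x : R) : 1 < x -> is_derive li x (/ ln x).
Proof.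
  intros hx.
  apply (is_derive_ext_loc (fun z => li x + RInt (fun t => / ln t) x z)).
  - apply (locally_interval _ x 1 p_infty); simpl; trivial.
    intros z hz _. symmetry. now apply li_Chasles.
  - replace (/ ln x) with (plus 0 (/ ln x)) by (unfold plus; simpl; ring).
    apply is_derive_Rplus; [exact (@is_derive_const R_AbsRing R_NormedModule (li x) x)|].
    now apply is_derive_RInt_inv_ln_gt1.
Qed.

(** * The truncated expansion of [exp u / u] and its remainder kernels *)

Lemma INR_fact_pos (k : nat) : 0 < INR (fact k).
Proof. apply lt_0_INR, lt_O_fact. Qed.

Definition texp (k : nat) (z : R) : R := sum_f_R0 (fun j => z ^ j / INR (fact j)) k.

Lemma texp_0 (k : nat) : texp k 0 = 1.
Proof.
  induction k as [|k IH]; unfold texp in *.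
  - simpl. field.
  - rewrite tech5, IH, (pow_i (S k)) by lia. unfold Rdiv. ring.
Qed.

Lemma texp_nonneg (k : nat) (z : R) : 0 <= z -> 0 <= texp k z.
Proof.
  intros hz. apply cond_pos_sum. intros j.
  apply Rdiv_le_0_compat; [now apply pow_le|apply INR_fact_pos].
Qed.

(** Since $z^j = 2^j (z/2)^j$, the factor $2^k$ pays for halving the argument. Against $e^{-u}$ this
    leaves the decay $e^{-u/2}$. *)
Lemma texp_le_exp_half (k : nat) (z : R) : 0 <= z -> texp k z <= 2 ^ k * exp (z / 2).
Proof.
  intros hz. apply Rle_trans with (2 ^ k * texp k (z / 2)).
  - unfold texp. rewrite scal_sum. apply sum_Rle. intros j hj.
    replace (z ^ j) with ((z / 2) ^ j * 2 ^ j).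
    2:{ rewrite <- Rpow_mult_distr. f_equal. field. }
    assert (h1 : 2 ^ j <= 2 ^ k) by (apply Rle_pow; [lra|lia]).
    assert (h2 : 0 <= (z / 2) ^ j / INR (fact j)).
    { apply Rdiv_le_0_compat; [apply pow_le; lra|apply INR_fact_pos]. }
    unfold Rdiv in *. nra.
  - apply Rmult_le_compat_l; [apply pow_le; lra|].
    apply exp_ge_taylor. lra.
Qed.

(** Differentiating the Taylor polynomial lowers its degree with a minus sign, so only the top term
    survives. This is repeated integration by parts of $e^u (c-u)^k$ in closed form. *)
Lemma is_derive_exp_texp (k : nat) (c u : R) :
  is_derive (fun u => exp u * texp k (c - u)) u (exp u * ((c - u) ^ k / INR (fact k))).
Proof.
  induction k as [|k IH].
  - unfold texp; simpl. auto_derive; trivial. field.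
  - apply (is_derive_ext (fun u => exp u * texp k (c - u)
                            + exp u * ((c - u) ^ S k / INR (fact (S k))))).
    { intros t. unfold texp. now rewrite tech5, Rmult_plus_distr_l. }
    assert (hF : INR (fact (S k)) = INR (S k) * INR (fact k)) by now rewrite <- mult_INR.
    pose proof (INR_fact_pos k). pose proof (lt_0_INR (S k) ltac:(lia)).
    set (F := INR (fact (S k))) in *. eapply is_derive_eq.
    + apply is_derive_Rplus; [exact IH|].
      auto_derive; trivial.
    + change (match k with O => 1 | S _ => INR k + 1 end) with (INR (S k)).
      rewrite hF. simpl pow. unfold Rminus. set (z := (c + - u) ^ k). field. lra.
Qed.

(* [kfun m c u] is the antiderivative in [u] of [exp u * sum_(k <= m) (c - u)^k / c^(k+1)],
   the truncation of the expansion of [exp u / u] about [u = c]. *)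
Definition kfun (m : nat) (c u : R) : R :=
  sum_f_R0 (fun k => INR (fact k) / c ^ S k * (exp u * texp k (c - u))) m.

Lemma is_derive_kfun_sum (m : nat) (c u : R) :
  0 < c ->
  is_derive (kfun m c) u (exp u * sum_f_R0 (fun k => (c - u) ^ k / c ^ S k) m).
Proof.
  intros hc.
  assert (hk : forall k, is_derive (fun u => INR (fact k) / c ^ S k * (exp u * texp k (c - u)))
             u (exp u * ((c - u) ^ k / c ^ S k))).
  { intros k. eapply is_derive_eq.
    - exact (is_derive_scal _ u _ _ (is_derive_exp_texp k c u)).
    - pose proof (INR_fact_pos k). pose proof (pow_lt c (S k) hc).
      field. lra. }
  induction m as [|m IH].
  - unfold kfun. simpl sum_f_R0. apply (hk O).
  - unfold kfun in *. simpl sum_f_R0. rewrite Rmult_plus_distr_l.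
    apply is_derive_Rplus; [exact IH|apply (hk (S m))].
Qed.

(** Geometric sum of ratio $(c-u)/c$, whose formal full series is $1/u$; the defect
    $((c-u)/c)^{m+1}/u$ becomes the remainder kernel. *)
Lemma truncated_geometric_sum (m : nat) (c u : R) :
  0 < c -> u <> 0 ->
  sum_f_R0 (fun k => (c - u) ^ k / c ^ S k) m = (1 - ((c - u) / c) ^ S m) / u.
Proof.
  intros hc hu. induction m as [|m IH].
  - simpl. field. lra.
  - rewrite tech5, IH. pose proof (pow_lt c m hc).
    assert (hq : ((c - u) / c) ^ m = (c - u) ^ m / c ^ m)
      by (unfold Rdiv; now rewrite Rpow_mult_distr, pow_inv).
    rewrite <- !tech_pow_Rmult, hq. generalize ((c - u) ^ m). intros z. field. lra.
Qed.

Lemma is_derive_kfun (m : nat) (c u : R) :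
  0 < c -> u <> 0 ->
  is_derive (kfun m c) u (exp u * ((1 - ((c - u) / c) ^ S m) / u)).
Proof.
  intros hc hu. rewrite <- truncated_geometric_sum by trivial. now apply is_derive_kfun_sum.
Qed.

(** Vanishing at $-\infty$ fixes the constant of integration on the side [t < 1]. *)
Lemma kfun_decay (m : nat) (c : R) :
  0 < c -> exists C, 0 < C /\ forall u, 0 <= u -> 0 <= kfun m c (- u) <= C * exp (- (u / 2)).
Proof.
  intros hc.
  assert (hk : forall k, exists C, 0 < C /\ forall u, 0 <= u ->
     0 <= INR (fact k) / c ^ S k * (exp (- u) * texp k (c - - u)) <= C * exp (- (u / 2))).
  { intros k. pose proof (INR_fact_pos k) as hf. pose proof (pow_lt c (S k) hc) as hp.
    pose proof (Rdiv_lt_0_compat _ _ hf hp) as hq.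
    exists (INR (fact k) / c ^ S k * (2 ^ k * exp (c / 2))). split.
    - pose proof (exp_pos (c / 2)). pose proof (pow_lt 2 k ltac:(lra)).
      apply Rmult_lt_0_compat; [|apply Rmult_lt_0_compat]; trivial.
    - intros u hu. pose proof (exp_pos (- u)).
      pose proof (texp_nonneg k (c - - u) ltac:(lra)).
      split; [apply Rmult_le_pos; [|apply Rmult_le_pos]; lra|].
      rewrite Rmult_assoc. apply Rmult_le_compat_l; [lra|].
      replace (2 ^ k * exp (c / 2) * exp (- (u / 2)))
        with (exp (- u) * (2 ^ k * exp ((c - - u) / 2))).
      + apply Rmult_le_compat_l; [lra|]. apply texp_le_exp_half. lra.
      + rewrite (Rmult_comm (exp (- u))), !Rmult_assoc, <- !exp_plus. do 2 f_equal. field. }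
  induction m as [|m [C [hC IH]]]; [exact (hk O)|].
  destruct (hk (S m)) as [D [hD hS]]. exists (C + D). split; [lra|].
  intros u hu. specialize (IH u hu). specialize (hS u hu).
  unfold kfun in *. rewrite tech5. lra.
Qed.

(** With $u=-\ln t$ this is $-\int_u^\infty e^{-v}((c+v)/c)^{m+1}\,dv/v$, expressed through a proper
    integral and an explicit antiderivative. *)
Definition below_one (m : nat) (c u : R) : R :=
  RInt (fun t => / ln t) 0 (exp (- u)) - kfun m c (- u).

(** The counterpart for [t > 1]: $\int_u^c e^{v}((c-v)/c)^{m+1}\,dv/v$. The constant [kfun m c c]
    normalises it to 0 at [u = c]. *)
Definition above_one (m : nat) (c u : R) : R :=
  RInt (fun t => / ln t) (exp u) (exp c) + kfun m c u - kfun m c c.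

Lemma exp_neg_bound (u : R) : 0 < u -> 0 < exp (- u) < 1.
Proof.
  intros hu. split; [apply exp_pos|]. rewrite <- exp_0. apply exp_increasing. lra.
Qed.

Lemma exp_le_mono (x y : R) : x <= y -> exp x <= exp y.
Proof. intros [h | ->]; [left; now apply exp_increasing | right; trivial]. Qed.

Lemma exp_gt_1 (u : R) : 0 < u -> 1 < exp u.
Proof. intros hu. rewrite <- exp_0. now apply exp_increasing. Qed.

Lemma is_derive_below_one (m : nat) (c u : R) :
  0 < c -> 0 < u ->
  is_derive (below_one m c) u (exp (- u) * ((c + u) / c) ^ S m / u).
Proof.
  intros hc hu. unfold below_one. eapply is_derive_eq.
  - apply (@is_derive_minus R_AbsRing R_NormedModule).
    + apply (is_derive_Rcomp (fun b => RInt (fun t => / ln t) 0 b) (fun u => exp (- u))).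
      * apply is_derive_RInt_inv_ln_lt1. now apply exp_neg_bound.
      * auto_derive; trivial.
    + apply (is_derive_Rcomp (kfun m c) (fun u => - u)).
      * apply is_derive_kfun; lra.
      * auto_derive; trivial.
  - rewrite ln_exp. unfold minus, plus, opp.
    replace (c - - u) with (c + u) by ring. simpl. field. lra.
Qed.

Lemma is_derive_above_one (m : nat) (c u : R) :
  0 < c -> 0 < u ->
  is_derive (above_one m c) u (- (exp u * ((c - u) / c) ^ S m / u)).
Proof.
  intros hc hu. unfold above_one, Rminus at 1. eapply is_derive_eq.
  - apply is_derive_Rplus; [apply is_derive_Rplus|].
    + apply (is_derive_Rcomp (fun b => RInt (fun t => / ln t) b (exp c)) exp).
      * apply is_derive_RInt_inv_ln_gt1_lower; now apply exp_gt_1.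
      * auto_derive; trivial.
    + apply is_derive_kfun; lra.
    + exact (@is_derive_const R_AbsRing R_NormedModule (- kfun m c c) u).
  - rewrite ln_exp. unfold zero; simpl. field. lra.
Qed.

Lemma above_one_end (m : nat) (c : R) : above_one m c c = 0.
Proof. unfold above_one. rewrite (@RInt_point R_CompleteNormedModule). unfold zero; simpl. ring. Qed.

Lemma below_one_decay (m : nat) (c : R) :
  0 < c -> exists C, 0 < C /\ forall u, 1 <= u -> Rabs (below_one m c u) <= C * exp (- (u / 2)).
Proof.
  intros hc. destruct (kfun_decay m c hc) as [C [hC h]].
  exists (1 + C). split; [lra|]. intros u hu.
  specialize (h u ltac:(lra)).
  assert (hI : Rabs (RInt (fun t => / ln t) 0 (exp (- u))) <= exp (- u)).
  { pose proof (exp_neg_bound u ltac:(lra)).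
    replace (exp (- u)) with ((exp (- u) - 0) * 1) at 2 by ring.
    apply abs_RInt_le_const; [lra|apply ex_RInt_inv_ln_lt1; lra|].
    intros t ht. destruct (Req_dec t 0) as [->|].
    - rewrite ln_nonpos_eq, Rinv_0, Rabs_R0 by lra. lra.
    (* Here [1 <= u] matters: it gives $|\ln t|\ge 1$, so the integrand is at most 1 in absolute
       value. *)
    - assert (ln t <= - u) by (rewrite <- (ln_exp (- u)); apply ln_le; lra).
      rewrite Rabs_inv, Rabs_left by lra. rewrite <- Rinv_1. apply Rinv_le_contravar; lra. }
  assert (exp (- u) <= exp (- (u / 2))) by (apply exp_le_mono; lra).
  unfold below_one. apply Rabs_le. apply Rabs_le_between in hI. lra.
Qed.

Lemma exp_small (C u eps : R) :
  0 < C -> 0 < eps -> exists t, u <= t /\ C * exp (- (t / 2)) <= eps.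
Proof.
  intros hC he. assert (h0 : 0 < C / eps) by now apply Rdiv_lt_0_compat.
  exists (Rmax u (2 * (C / eps))). split; [apply Rmax_l|].
  set (t := Rmax u (2 * (C / eps))). assert (ht : 2 * (C / eps) <= t) by apply Rmax_r.
  pose proof (exp_ineq1_le (t / 2)) as h.
  rewrite exp_Ropp.
  assert (/ exp (t / 2) <= / (C / eps)) by (apply Rinv_le_contravar; lra).
  replace eps with (C * / (C / eps)) by (field; lra).
  apply Rmult_le_compat_l; lra.
Qed.

(** It increases to its limit 0 at infinity; one far point [t], within [eps] of the limit, replaces
    the passage to infinity. *)
Lemma below_one_nonpos (m : nat) (c u : R) : 0 < c -> 1 <= u -> below_one m c u <= 0.
Proof.
  intros hc hu. destruct (below_one_decay m c hc) as [C [hC h]].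
  apply le_epsilon. intros eps he. destruct (exp_small C u eps hC he) as [t [ht hs]].
  specialize (h t ltac:(lra)). apply Rabs_le_between in h.
  enough (below_one m c u <= below_one m c t) by lra.
  apply (derive_nonneg_le _ (fun u => exp (- u) * ((c + u) / c) ^ S m / u)); trivial.
  - intros z hz. apply is_derive_below_one; lra.
  - intros z hz. pose proof (exp_pos (- z)).
    assert (0 < (c + z) / c) by (apply Rdiv_lt_0_compat; lra).
    apply Rdiv_le_0_compat; [|lra]. apply Rmult_le_pos; [lra|]. apply pow_le. lra.
Qed.

Lemma exp_pow (x : R) (n : nat) : exp x ^ n = exp (INR n * x).
Proof.
  induction n as [|n IH]; [simpl; now rewrite Rmult_0_l, exp_0|].
  simpl pow. rewrite IH, <- exp_plus. f_equal. rewrite S_INR. ring.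
Qed.

(** This form serves all $v\ge 0$: the subtracted term is at least $v^2/4$ for $v\le 1$ (Gaussian
    range) and at least $v/4$ for $v\ge 1$ (exponential tail). At $v=1/n$ it also makes the Stirling
    increments telescope. *)
Lemma ln_1p_le (v : R) : 0 <= v -> ln (1 + v) <= v - v ^ 2 / (2 * (1 + v)).
Proof.
  intros hv.
  pose (F := fun v => v - v ^ 2 / (2 * (1 + v)) - ln (1 + v)).
  enough (h : F 0 <= F v).
  { unfold F in h. rewrite Rplus_0_r, ln_1 in h. lra. }
  apply (derive_nonneg_le F (fun v => v ^ 2 / (2 * (1 + v) ^ 2))); trivial.
  - intros x hx. unfold F. auto_derive; [repeat split; lra|]. field. lra.
  - intros x hx. apply Rdiv_le_0_compat; [nra|]. nra.
Qed.

(** The right side is $-\frac23 v^3 - \cdots$. Multiplied by [c], with [v = u / c], it is the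
    logarithm of $q(u)/p(u)$. *)
Lemma ln_ratio_ge (v : R) : 0 <= v <= 1 / 2 -> - v ^ 3 <= ln (1 - v) - ln (1 + v) + 2 * v.
Proof.
  intros hv.
  pose (F := fun v => ln (1 - v) - ln (1 + v) + 2 * v + v ^ 3).
  enough (h : F 0 <= F v).
  { unfold F in h. rewrite Rplus_0_r, Rminus_0_r, ln_1 in h. lra. }
  apply (derive_nonneg_le F (fun v => v ^ 2 * (1 - 3 * v ^ 2) / (1 - v ^ 2))); [lra| |].
  - intros x hx. unfold F. auto_derive; [repeat split; lra|]. field. nra.
  - intros x hx. assert (0 <= x ^ 2 <= 1 / 4) by (simpl; nra).
    apply Rdiv_le_0_compat; [apply Rmult_le_pos|]; lra.
Qed.

Lemma ln_ratio_nonpos (v : R) : 0 <= v < 1 -> ln (1 - v) - ln (1 + v) + 2 * v <= 0.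
Proof.
  intros hv.
  pose (F := fun v => ln (1 - v) - ln (1 + v) + 2 * v).
  enough (h : F v <= F 0).
  { unfold F in h. rewrite Rplus_0_r, Rminus_0_r, ln_1 in h. lra. }
  apply (derive_nonpos_ge F (fun v => - (2 * v ^ 2 / (1 - v ^ 2)))); [lra| |].
  - intros x hx. unfold F. auto_derive; [repeat split; lra|]. field. nra.
  - intros x hx. enough (0 <= 2 * x ^ 2 / (1 - x ^ 2)) by lra.
    apply Rdiv_le_0_compat; nra.
Qed.

(** * Size of the kernels [p], [q] and of their difference *)

Section Kernels.
Variable n : nat.
Hypothesis hn : (1 <= n)%nat.
Let c := INR n.

Let hc : 1 <= c.
Proof. unfold c. change 1 with (INR 1). now apply le_INR. Qed.

Definition pker (u : R) : R := exp (- u) * ((c + u) / c) ^ n.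
Definition qker (u : R) : R := exp u * ((c - u) / c) ^ n.

Lemma pker_exp (u : R) : 0 <= u -> pker u = exp (c * (ln (1 + u / c) - u / c)).
Proof.
  intros hu. unfold pker. assert (0 <= u / c) by (apply Rdiv_le_0_compat; lra).
  replace ((c + u) / c) with (exp (ln (1 + u / c))).
  2:{ rewrite exp_ln by lra. field. lra. }
  rewrite exp_pow, <- exp_plus. f_equal. fold c. field. lra.
Qed.

Lemma qker_exp (u : R) : 0 <= u < c -> qker u = exp (c * (ln (1 - u / c) + u / c)).
Proof.
  intros hu. unfold qker. 
  assert (u / c < 1) by (apply Rlt_div_l; lra).
  replace ((c - u) / c) with (exp (ln (1 - u / c))).
  2:{ rewrite exp_ln by lra. field. lra. }
  rewrite exp_pow, <- exp_plus. f_equal. fold c. field. lra.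
Qed.

Lemma qker_end : qker c = 0.
Proof.
  unfold qker. rewrite Rminus_diag. unfold Rdiv. rewrite Rmult_0_l, pow_i by lia. ring.
Qed.

Lemma pker_pos (u : R) : 0 <= u -> 0 < pker u.
Proof. intros. rewrite pker_exp by trivial. apply exp_pos. Qed.

Lemma qker_nonneg (u : R) : 0 <= u <= c -> 0 <= qker u.
Proof.
  intros h. apply Rmult_le_pos; [left; apply exp_pos|]. apply pow_le.
  apply Rdiv_le_0_compat; lra.
Qed.

Lemma pker_le_1 (u : R) : 0 <= u -> pker u <= 1.
Proof.
  intros hu. rewrite pker_exp by trivial.
  apply Rle_trans with (exp 0); [apply exp_le_mono|rewrite exp_0; lra].
  assert (0 <= u / c) by (apply Rdiv_le_0_compat; lra).
  pose proof (ln_le_sub_1 (1 + u / c) ltac:(lra)).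
  rewrite <- (Rmult_0_r c). apply Rmult_le_compat_l; lra.
Qed.

(** The logarithm of $q/p$ is nonpositive. The endpoint [u = c] is treated apart: [ln 0 = 0] by
    convention, so the exponential form of [q] fails there, while [q] itself vanishes. *)
Lemma qker_le_pker (u : R) : 0 <= u <= c -> qker u <= pker u.
Proof.
  intros hu. destruct (Req_dec u c) as [->|].
  - rewrite qker_end. left. apply pker_pos. lra.
  - rewrite pker_exp, qker_exp by lra. apply exp_le_mono.
    assert (0 <= u / c) by (apply Rdiv_le_0_compat; lra).
    assert (u / c < 1) by (apply Rlt_div_l; lra).
    apply Rmult_le_compat_l; [lra|].
    pose proof (ln_ratio_nonpos (u / c) ltac:(lra)). lra.
Qed.

Lemma pker_gauss (u : R) : 0 <= u <= c -> pker u <= exp (- (u ^ 2 / (4 * c))).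
Proof.
  intros hu. rewrite pker_exp by lra. apply exp_le_mono.
  replace u with (c * (u / c)) at 3 by (field; lra).
  assert (hv : 0 <= u / c) by (apply Rdiv_le_0_compat; lra).
  assert (hv1 : u / c <= 1) by (apply Rle_div_l; lra).
  set (v := u / c) in *.
  pose proof (ln_1p_le v hv) as h.
  replace (- ((c * v) ^ 2 / (4 * c))) with (c * (- (v ^ 2 / 4))) by (field; lra).
  apply Rmult_le_compat_l; [lra|].
  enough (v ^ 2 / 4 <= v ^ 2 / (2 * (1 + v))) by lra.
  apply Rmult_le_compat_l; [nra|]. apply Rinv_le_contravar; lra.
Qed.

Lemma pker_tail (u : R) : c <= u -> pker u <= exp (- (u / 4)).
Proof.
  intros hu. rewrite pker_exp by lra. apply exp_le_mono.
  replace u with (c * (u / c)) at 3 by (field; lra).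
  assert (hv1 : 1 <= u / c) by (apply Rle_div_r; lra).
  set (v := u / c) in *.
  pose proof (ln_1p_le v ltac:(lra)) as h.
  replace (- (c * v / 4)) with (c * (- (v / 4))) by field.
  apply Rmult_le_compat_l; [lra|].
  enough (v / 4 <= v ^ 2 / (2 * (1 + v))) by lra.
  assert (0 <= v * (v - 1)) by (apply Rmult_le_pos; lra).
  rewrite <- Rle_div_r; lra.
Qed.

(** With [v = u / c]: for $v\le 1/2$, $1-q/p\le -\ln(q/p)\le c v^3$. For $v>1/2$ the trivial bound
    $p-q\le p$ suffices, because $8cv^3\ge 1$; this dictates the constant 8. *)
Lemma pker_sub_qker_le (u : R) :
  0 <= u <= c -> pker u - qker u <= 8 * c * (u / c) ^ 3 * pker u.
Proof.
  intros hu.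
  assert (hv : 0 <= u / c) by (apply Rdiv_le_0_compat; lra).
  assert (hp := pker_pos u ltac:(lra)).
  destruct (Rle_dec (u / c) (1 / 2)) as [h|h].
  - assert (hr := ln_ratio_ge (u / c) ltac:(lra)).
    assert (hq : qker u = pker u * exp (c * (ln (1 - u / c) - ln (1 + u / c) + 2 * (u / c)))).
    { assert (u < c).
      { replace u with (c * (u / c)) by (field; lra). nra. }
      rewrite pker_exp, qker_exp, <- exp_plus by lra. f_equal. ring. }
    set (v := u / c) in *. set (D := ln (1 - v) - ln (1 + v) + 2 * v) in *.
    pose proof (exp_ineq1_le (c * D)) as he.
    rewrite hq.
    assert (0 <= v ^ 3) by now apply pow_le.
    assert (- (c * v ^ 3) <= c * D) by nra.
    assert (0 <= c * v ^ 3) by nra.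
    enough (pker u * (1 - exp (c * D)) <= pker u * (8 * (c * v ^ 3))) by lra.
    apply Rmult_le_compat_l; lra.
  - assert (hq := qker_nonneg u hu). set (v := u / c) in *.
    assert (1 / 4 <= v ^ 2) by nra.
    assert (1 / 8 <= v ^ 3) by (simpl in *; nra).
    assert (pker u * 1 <= pker u * (8 * c * v ^ 3)) by (apply Rmult_le_compat_l; nra).
    lra.
Qed.

(* [w = sqrt z]: the rational majorant of [z exp (- z)] has an elementary antiderivative in [w]. *)
Lemma sq_exp_neg_sq_le (w : R) : 0 <= w -> w ^ 2 * exp (- w ^ 2) <= 8 / (1 + w) ^ 2.
Proof.
  intros hw. rewrite <- Rle_div_r by nra.
  (* Squaring $e^{z/2}\ge 1+z/2$ gives a quadratic in $z=w^2$, enough to dominate $w^2(1+w)^2\le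
     w^2(2+2w^2)$. *)
  assert (h : (1 + w ^ 2 / 2) ^ 2 <= exp (w ^ 2)).
  { replace (w ^ 2) with (w ^ 2 / 2 + w ^ 2 / 2) at 2 by field.
    rewrite exp_plus. pose proof (exp_ineq1_le (w ^ 2 / 2)). nra. }
  rewrite exp_Ropp. pose proof (exp_pos (w ^ 2)) as he.
  replace (w ^ 2 * / exp (w ^ 2) * (1 + w) ^ 2) with (w ^ 2 * (1 + w) ^ 2 / exp (w ^ 2))
    by (field; lra).
  apply Rle_div_l; [lra|].
  assert ((1 + w) ^ 2 <= 2 + 2 * w ^ 2) by (pose proof (pow2_ge_0 (1 - w)); lra).
  assert (0 <= w ^ 2) by apply pow2_ge_0.
  apply Rle_trans with (w ^ 2 * (2 + 2 * w ^ 2)); [now apply Rmult_le_compat_l|].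
  simpl pow in h |- *. nra.
Qed.

(** The scaling $w=u/(2\sqrt c)$ turns the Gaussian into $e^{-w^2}$ and $8c(u/c)^3/u$ into
    $32w^2/c$; the majorant with constant 8 then gives 256. *)
Lemma kernel_difference_bound (u : R) :
  0 < u <= c -> (pker u - qker u) / u <= 256 / c / (1 + u / (2 * sqrt c)) ^ 2.
Proof.
  intros hu. set (w := u / (2 * sqrt c)).
  assert (hs : 0 < sqrt c) by (apply sqrt_lt_R0; lra).
  assert (hs2 : sqrt c * sqrt c = c) by (apply sqrt_sqrt; lra).
  assert (hw : 0 <= w) by (apply Rdiv_le_0_compat; lra).
  assert (hw2 : u ^ 2 / (4 * c) = w ^ 2).
  { unfold w. rewrite <- hs2 at 1. field. lra. }
  pose proof (pker_sub_qker_le u ltac:(lra)) as h1.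
  pose proof (pker_gauss u ltac:(lra)) as h2.
  pose proof (sq_exp_neg_sq_le w hw) as h3.
  rewrite hw2 in h2.
  apply Rle_trans with (32 / c * (w ^ 2 * exp (- w ^ 2))).
  - apply Rle_div_l; [lra|]. eapply Rle_trans; [exact h1|].
    replace (32 / c * (w ^ 2 * exp (- w ^ 2)) * u) with (8 * c * (u / c) ^ 3 * exp (- w ^ 2)).
    + apply Rmult_le_compat_l; trivial.
      assert (0 <= u / c) by (apply Rdiv_le_0_compat; lra).
      apply Rmult_le_pos; [lra|]. now apply pow_le.
    + rewrite <- hw2 at 2. field. lra.
  - replace (256 / c / (1 + w) ^ 2) with (32 / c * (8 / (1 + w) ^ 2)).
    + apply Rmult_le_compat_l; trivial. apply Rdiv_le_0_compat; lra.
    + field. lra.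
Qed.

End Kernels.

(** * The error at integer values of [ln x] tends to zero *)

Section Remainder.
Variable m : nat.
Let c := INR (S m).

Let hc : 1 <= c.
Proof. unfold c. rewrite S_INR. pose proof (pos_INR m). lra. Qed.

Let hn : (1 <= S m)%nat.
Proof. lia. Qed.

Lemma is_derive_below_one_pker (u : R) :
  0 < u -> is_derive (below_one m c) u (pker (S m) u / u).
Proof. intros hu. apply is_derive_below_one; lra. Qed.

Lemma is_derive_above_one_qker (u : R) :
  0 < u -> is_derive (above_one m c) u (- (qker (S m) u / u)).
Proof. intros hu. apply is_derive_above_one; lra. Qed.

(** Beyond [c >= 1] the density $p(v)/v$ is at most $e^{-v/4}$, whose tail integral is
    $4e^{-u/4}$. *)
Lemma below_one_ge (u : R) : c <= u -> - (4 * exp (- (u / 4))) <= below_one m c u.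
Proof.
  intros hu. destruct (below_one_decay m c ltac:(lra)) as [C [hC h]].
  apply le_epsilon. intros eps he. destruct (exp_small C u eps hC he) as [t [ht hs]].
  specialize (h t ltac:(lra)). apply Rabs_le_between in h.
  pose (F := fun u => below_one m c u + 4 * exp (- (u / 4))).
  assert (hF : F t <= F u).
  { apply (derive_nonpos_ge F (fun u => pker (S m) u / u + - exp (- (u / 4)))); trivial.
    - intros z hz. apply is_derive_Rplus; [apply is_derive_below_one_pker; lra|].
      auto_derive; trivial. unfold Rdiv; field.
    - intros z hz. pose proof (pker_tail (S m) hn z ltac:(fold c; lra)) as hp.
      pose proof (pker_pos (S m) hn z ltac:(lra)).
      enough (pker (S m) z / z <= exp (- (z / 4))) by lra.
      apply Rle_div_l; [lra|]. nra. }
  unfold F in hF. pose proof (exp_pos (- (t / 4))). lra.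
Qed.

(** The derivative is $(p-q)/u\ge 0$, and at [u = c] only the nonpositive [below_one] remains. In
    the limit $u\to 0$ this makes the error at integers nonnegative. *)
Lemma below_above_nonpos (u : R) : 0 < u <= c -> below_one m c u + above_one m c u <= 0.
Proof.
  intros hu. pose (F := fun u => below_one m c u + above_one m c u).
  assert (hF : F u <= F c).
  { apply (derive_nonneg_le F (fun u => pker (S m) u / u + - (qker (S m) u / u))); [lra| |].
    - intros z hz. apply is_derive_Rplus;
        [apply is_derive_below_one_pker|apply is_derive_above_one_qker]; lra.
    - intros z hz. pose proof (qker_le_pker (S m) hn z ltac:(fold c; lra)).
      replace (_ + _) with ((pker (S m) z - qker (S m) z) / z) by (field; lra).
      apply Rdiv_le_0_compat; lra. }
  unfold F in hF. rewrite above_one_end in hF.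
  pose proof (below_one_nonpos m c c ltac:(lra) hc). lra.
Qed.

(** [G] is minus an antiderivative of the majorant of $(p-q)/u$, whence $512 = 2\cdot 256$; the
    exponential accounts for the tail of [p] beyond [c]. *)
Lemma below_above_ge (u : R) :
  0 < u <= c ->
  - (512 / sqrt c + 4 * exp (- (c / 4))) <= below_one m c u + above_one m c u.
Proof.
  intros hu. assert (hs : 0 < sqrt c) by (apply sqrt_lt_R0; lra).
  pose (G := fun u => 512 / sqrt c / (1 + u / (2 * sqrt c))).
  pose (F := fun u => below_one m c u + above_one m c u + G u).
  assert (hG : forall z, 0 <= z -> 0 < 1 + z / (2 * sqrt c)).
  { intros z hz. enough (0 <= z / (2 * sqrt c)) by lra. apply Rdiv_le_0_compat; lra. }
  assert (hF : F c <= F u).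
  { apply (derive_nonpos_ge F (fun u => pker (S m) u / u + - (qker (S m) u / u)
             + - (256 / c / (1 + u / (2 * sqrt c)) ^ 2))); [lra| |].
    - intros z hz. specialize (hG z ltac:(lra)).
      apply is_derive_Rplus; [apply is_derive_Rplus|];
        [apply is_derive_below_one_pker|apply is_derive_above_one_qker|]; try lra.
      unfold G. auto_derive; [unfold Rdiv in hG; lra|].
      assert (hs2 : sqrt c * sqrt c = c) by (apply sqrt_sqrt; lra).
      replace (256 / c) with (256 / (sqrt c * sqrt c)) by now rewrite hs2. field. split; lra.
    - intros z hz. pose proof (kernel_difference_bound (S m) hn z ltac:(fold c; lra)) as h.
      fold c in h. unfold Rdiv in h at 1. rewrite Rmult_minus_distr_r in h.
      unfold Rdiv at 1 2. lra. }
  unfold F in hF. rewrite above_one_end in hF.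
  pose proof (below_one_ge c ltac:(lra)).
  assert (0 < G c) by (apply Rdiv_lt_0_compat; [apply Rdiv_lt_0_compat|apply hG]; lra).
  assert (G u <= 512 / sqrt c).
  { unfold G. apply Rle_div_l; [apply hG; lra|].
    assert (0 < 512 / sqrt c) by (apply Rdiv_lt_0_compat; lra).
    enough (0 <= u / (2 * sqrt c)) by nra. apply Rdiv_le_0_compat; lra. }
  lra.
Qed.

(* The excised interval [1 - d, 1 + d] is not symmetric in [u = ln t]; this bounds the cost. *)
Lemma above_one_shift (d : R) :
  0 < d -> d <= 1 / 2 -> 2 * d <= c ->
  0 <= above_one m c (ln (1 + d)) - above_one m c (- ln (1 - d)) <= 8 * d.
Proof.
  intros hd hd2 hdc.
  set (a := ln (1 + d)). set (b := - ln (1 - d)).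
  assert (ha1 := ln_le_sub_1 (1 + d) ltac:(lra)).
  assert (ha2 := ln_ge_1_sub_inv (1 + d) ltac:(lra)).
  assert (hb1 := ln_le_sub_1 (1 - d) ltac:(lra)).
  assert (hb2 := ln_ge_1_sub_inv (1 - d) ltac:(lra)).
  fold a in ha1, ha2.
  assert (e1 : d / (1 + d) <= a) by (replace (d / (1 + d)) with (1 - / (1 + d)) by (field; lra); lra).
  assert (e2 : b <= d / (1 - d)).
  { replace (d / (1 - d)) with (- (1 - / (1 - d))) by (field; lra). unfold b. lra. }
  assert (hab : a <= b) by (unfold b; lra).
  assert (hbc : b <= c).
  { enough (d / (1 - d) <= 2 * d) by lra. apply Rle_div_l; nra. }
  assert (ha : d / 2 <= a).
  { enough (d / 2 <= d / (1 + d)) by lra. apply Rmult_le_compat_l; [lra|].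
    apply Rinv_le_contravar; lra. }
  split.
  - enough (above_one m c b <= above_one m c a) by lra.
    apply (derive_nonpos_ge _ (fun u => - (qker (S m) u / u))); trivial.
    + intros z hz. apply is_derive_above_one_qker. lra.
    + intros z hz. pose proof (qker_nonneg (S m) hn z ltac:(fold c; lra)).
      enough (0 <= qker (S m) z / z) by lra. apply Rdiv_le_0_compat; lra.
  (* On $[a,b]$ one has $q(z)/z\le 1/z\le 2/d$, while $b-a\le 4d^2$; the product is $8d$. *)
  - pose (F := fun u => above_one m c u + 2 / d * u).
    assert (hF : F a <= F b).
    { apply (derive_nonneg_le F (fun u => - (qker (S m) u / u) + 2 / d)); trivial.
      - intros z hz. apply is_derive_Rplus; [apply is_derive_above_one_qker; lra|].
        auto_derive; trivial. ring.
      - intros z hz. pose proof (qker_le_pker (S m) hn z ltac:(fold c; lra)).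
        pose proof (pker_le_1 (S m) hn z ltac:(lra)).
        enough (qker (S m) z / z <= 2 / d) by lra.
        apply Rle_trans with (1 / z).
        + apply Rmult_le_compat_r; [|lra]. left. apply Rinv_0_lt_compat. lra.
        + replace (2 / d) with (1 / (d / 2)) by (field; lra).
          apply Rmult_le_compat_l; [lra|]. apply Rinv_le_contravar; lra. }
    unfold F in hF.
    assert (h : b - a <= 4 * d ^ 2).
    { enough (d / (1 - d) - d / (1 + d) <= 4 * d ^ 2) by lra.
      replace (d / (1 - d) - d / (1 + d)) with (2 * d ^ 2 / ((1 - d) * (1 + d))) by (field; lra).
      replace ((1 - d) * (1 + d)) with (1 - d ^ 2) by ring.
      assert (0 < d ^ 2 <= 1 / 4) by nra. apply Rle_div_l; nra. }
    assert (2 / d * (b - a) <= 8 * d).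
    { replace (8 * d) with (2 / d * (4 * d ^ 2)) by (field; lra).
      apply Rmult_le_compat_l; trivial. apply Rdiv_le_0_compat; lra. }
    lra.
Qed.

Lemma pv_decompose (d : R) :
  0 < d < 1 ->
  pv (exp c) d - kfun m c c
  = below_one m c (- ln (1 - d)) + above_one m c (ln (1 + d))
    + (kfun m c (ln (1 - d)) - kfun m c (ln (1 + d))).
Proof.
  intros hd. unfold pv, below_one, above_one. rewrite Ropp_involutive, !exp_ln by lra. ring.
Qed.

(** Unlike $e^u/u$, its truncated expansion is regular at [u = 0], so [kfun] is continuous across
    the singularity and its two boundary values cancel in the limit. *)
Lemma kfun_gap_small (eps : R) :
  0 < eps ->
  at_right 0 (fun d => Rabs (kfun m c (ln (1 - d)) - kfun m c (ln (1 + d))) < eps).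
Proof.
  intros he. pose (h := fun d => kfun m c (ln (1 - d)) - kfun m c (ln (1 + d))).
  assert (hk : is_derive (kfun m c) 0 (exp 0 * sum_f_R0 (fun k => (c - 0) ^ k / c ^ S k) m))
    by (apply is_derive_kfun_sum; lra).
  set (K := exp 0 * _) in hk.
  assert (hd : is_derive h 0 (- 1 * K + - (1 * K))).
  { apply is_derive_Rplus.
    - apply (is_derive_Rcomp (kfun m c) (fun d => ln (1 - d))).
      + now rewrite Rminus_0_r, ln_1.
      + auto_derive; [lra|field].
    - apply (@is_derive_opp R_AbsRing R_NormedModule).
      apply (is_derive_Rcomp (kfun m c) (fun d => ln (1 + d))).
      + now rewrite Rplus_0_r, ln_1.
      + auto_derive; [lra|field]. }
  apply is_derive_continuity_pt in hd. rewrite continuity_pt_locally in hd.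
  apply filter_le_within. generalize (hd (mkposreal eps he)). apply filter_imp.
  intros d. unfold h. rewrite Rminus_0_r, Rplus_0_r, ln_1, Rminus_diag, Rminus_0_r. trivial.
Qed.

Lemma li_exp_INR_bounds :
  kfun m c c - (512 / sqrt c + 4 * exp (- (c / 4))) <= li (exp c) <= kfun m c c.
Proof.
  (* A single small [d] is chosen for each [eps]. The budget is [eps / 4] for the principal value,
     [eps / 4] for the gap of [kfun], and [eps / 2] for the shift $8d$, whence [d < eps / 16]. *)
  assert (key : forall eps, 0 < eps -> exists s, Rabs s <= eps /\
    kfun m c c - (512 / sqrt c + 4 * exp (- (c / 4))) <= li (exp c) + s <= kfun m c c).
  { intros eps he.
    pose proof (lim_pv_li (exp c) (exp_gt_1 c ltac:(lra))) as hl.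
    assert (he4 : 0 < eps / 4) by lra.
    specialize (hl _ (locally_ball (li (exp c)) (mkposreal _ he4))).
    change (at_right 0 (fun d => Rabs (pv (exp c) d - li (exp c)) < eps / 4)) in hl.
    assert (h1 := kfun_gap_small _ he4).
    assert (hdp : 0 < Rmin (1 / 2) (eps / 16)) by (apply Rmin_glb_lt; lra).
    assert (h2 := at_right_0_lt _ hdp).
    destruct (filter_ex _ (filter_and _ _ hl (filter_and _ _ h1 h2))) as [d [b1 [b2 b3]]].
    pose proof (Rmin_l (1 / 2) (eps / 16)). pose proof (Rmin_r (1 / 2) (eps / 16)).
    pose proof (pv_decompose d ltac:(lra)) as hp.
    pose proof (above_one_shift d ltac:(lra) ltac:(lra) ltac:(lra)) as hs.
    assert (hb : 0 < - ln (1 - d) <= c).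
    { pose proof (ln_neg (1 - d) ltac:(lra)).
      pose proof (ln_ge_1_sub_inv (1 - d) ltac:(lra)).
      assert (/ (1 - d) <= / (1 / 2)) by (apply Rinv_le_contravar; lra). lra. }
    pose proof (below_above_nonpos _ hb). pose proof (below_above_ge _ hb).
    apply Rabs_def2 in b1. apply Rabs_def2 in b2.
    exists (below_one m c (- ln (1 - d)) + above_one m c (- ln (1 - d)) + kfun m c c - li (exp c)).
    split; [apply Rabs_le|]; lra. }
  split; apply le_epsilon; intros eps he; destruct (key eps he) as [s [hs h]];
    apply Rabs_le_between in hs; lra.
Qed.

End Remainder.

(** * Wallis' product and Stirling's formula *)

Definition wallis (n : nat) : R := RInt (fun t => sin t ^ n) 0 (PI / 2).

Lemma is_RInt_wallis (n : nat) : is_RInt (fun t => sin t ^ n) 0 (PI / 2) (wallis n).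
Proof.
  apply (@RInt_correct R_CompleteNormedModule), (@ex_RInt_continuous R_CompleteNormedModule).
  intros z _. apply (@ex_derive_continuous R_AbsRing R_NormedModule). auto_derive. trivial.
Qed.

Lemma wallis_0 : wallis 0 = PI / 2.
Proof.
  apply (@is_RInt_unique R_CompleteNormedModule).
  replace (PI / 2) with (scal (PI / 2 - 0) 1) at 2 by (unfold scal; simpl; unfold mult; simpl; ring).
  apply (@is_RInt_const R_NormedModule).
Qed.

Lemma wallis_1 : wallis 1 = 1.
Proof.
  apply (@is_RInt_unique R_CompleteNormedModule).
  replace 1 with (minus (- cos (PI / 2)) (- cos 0))
    by (rewrite cos_PI2, cos_0; unfold minus, plus, opp; simpl; ring).
  apply (is_RInt_derive (fun t => - cos t)).
  - intros x _. auto_derive; trivial. simpl. ring.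
  - intros x _. apply (@ex_derive_continuous R_AbsRing R_NormedModule). auto_derive. trivial.
Qed.

(** The integrand of the difference is the derivative of $-\cos t\,\sin^{n+1}t$, which vanishes at
    both endpoints. *)
Lemma wallis_rec (n : nat) : INR (S (S n)) * wallis (S (S n)) = INR (S n) * wallis n.
Proof.
  assert (h : is_RInt (fun t => INR (S (S n)) * sin t ^ S (S n) - INR (S n) * sin t ^ n)
                0 (PI / 2) 0).
  { replace 0 with (minus (- cos (PI / 2) * sin (PI / 2) ^ S n) (- cos 0 * sin 0 ^ S n)) at 2
      by (rewrite cos_PI2, sin_0, pow_i by lia; unfold minus, plus, opp; simpl; ring).
    apply (is_RInt_derive (fun t => - cos t * sin t ^ S n)).
    - intros x _. eapply is_derive_eq; [auto_derive; trivial|].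
      change (match n with O => 1 | S _ => INR n + 1 end) with (INR (S n)).
      rewrite (S_INR (S n)). simpl Init.Nat.pred. simpl pow.
      pose proof (sin2_cos2 x) as hsc. unfold Rsqr in hsc.
      replace (cos x * (cos x)) with (1 - sin x * sin x) by lra.
      transitivity (sin x * (sin x * sin x ^ n)
          - INR (S n) * (1 - sin x * sin x) * sin x ^ n); [|ring].
      replace (1 - sin x * sin x) with (cos x * cos x) by lra. ring.
    - intros x _. apply (@ex_derive_continuous R_AbsRing R_NormedModule). auto_derive. trivial. }
  apply (@is_RInt_unique R_CompleteNormedModule) in h.
  enough (INR (S (S n)) * wallis (S (S n)) - INR (S n) * wallis n = 0) by lra.
  rewrite <- h. symmetry. apply (@is_RInt_unique R_CompleteNormedModule).
  apply (@is_RInt_minus R_NormedModule); apply (@is_RInt_scal R_NormedModule); apply is_RInt_wallis.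
Qed.

Lemma wallis_prod (n : nat) : INR (S n) * wallis (S n) * wallis n = PI / 2.
Proof.
  induction n as [|n IH].
  - rewrite wallis_0, wallis_1. simpl. ring.
  - rewrite wallis_rec, <- IH. ring.
Qed.

Lemma wallis_nonneg (n : nat) : 0 <= wallis n.
Proof.
  pose proof PI_RGT_0.
  apply RInt_ge_0; [lra|eexists; apply is_RInt_wallis|].
  intros x hx. apply pow_le, sin_ge_0; lra.
Qed.

Lemma wallis_decr (n : nat) : wallis (S n) <= wallis n.
Proof.
  pose proof PI_RGT_0.
  apply RInt_le; [lra|eexists; apply is_RInt_wallis|eexists; apply is_RInt_wallis|].
  intros x hx. pose proof (SIN_bound x). simpl.
  rewrite <- (Rmult_1_l (sin x ^ n)) at 2. apply Rmult_le_compat_r; [|lra].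
  apply pow_le, sin_ge_0; lra.
Qed.

(** Monotonicity squeezes $W_n^2$ between consecutive products $W_nW_{n\pm1}$, which [wallis_prod]
    evaluates. *)
Lemma wallis_sq_bounds (n : nat) :
  INR n * wallis n ^ 2 <= PI / 2 <= INR (S n) * wallis n ^ 2.
Proof.
  pose proof (wallis_nonneg n). split.
  - destruct n as [|n]; [simpl; pose proof PI_RGT_0; lra|].
    rewrite <- (wallis_prod n). pose proof (wallis_decr n). pose proof (pos_INR (S n)).
    simpl pow. rewrite Rmult_1_r, <- Rmult_assoc. apply Rmult_le_compat_l; trivial.
    now apply Rmult_le_pos.
  - rewrite <- (wallis_prod n). pose proof (wallis_decr n). pose proof (pos_INR (S n)).
    simpl pow. rewrite Rmult_1_r, <- Rmult_assoc. apply Rmult_le_compat_r; trivial.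
    now apply Rmult_le_compat_l.
Qed.

Lemma wallis_even (n : nat) :
  wallis (2 * n) = INR (fact (2 * n)) / (4 ^ n * INR (fact n) ^ 2) * (PI / 2).
Proof.
  induction n as [|n IH]; [rewrite Nat.mul_0_r, wallis_0; simpl; field|].
  replace (2 * S n)%nat with (S (S (2 * n))) by lia.
  pose proof (wallis_rec (2 * n)) as h.
  pose proof (lt_0_INR (S (S (2 * n))) ltac:(lia)) as h2.
  apply (Rmult_eq_reg_l (INR (S (S (2 * n))))); [|lra].
  rewrite h, IH, !fact_simpl, !mult_INR.
  replace (INR (S (S (2 * n)))) with (2 * INR (S n))
    by (rewrite !S_INR, mult_INR; simpl; ring).
  pose proof (INR_fact_pos n). pose proof (pow_lt 4 n ltac:(lra)).
  pose proof (lt_0_INR (S n) ltac:(lia)).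
  rewrite <- (tech_pow_Rmult 4). field. lra.
Qed.

(** * Convergence of Stirling's sequence and its limit *)

Definition stirling (n : nat) : R :=
  INR (fact n) * exp (INR n) / (INR n ^ n * sqrt (INR n)).

Definition log_stirling (n : nat) : R :=
  ln (INR (fact n)) + INR n - (INR n + 1 / 2) * ln (INR n).

Lemma exp_log_stirling (n : nat) : (1 <= n)%nat -> exp (log_stirling n) = stirling n.
Proof.
  intros hn. assert (h : 0 < INR n) by (apply lt_0_INR; lia).
  pose proof (INR_fact_pos n). pose proof (sqrt_lt_R0 _ h). pose proof (pow_lt _ n h).
  unfold log_stirling, stirling, Rminus.
  rewrite exp_plus, exp_plus, exp_ln, exp_Ropp, Rmult_plus_distr_r, exp_plus by trivial.
  replace (exp (1 / 2 * ln (INR n))) with (sqrt (INR n)).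
  2:{ rewrite <- (exp_ln (sqrt (INR n))) by trivial. f_equal.
      rewrite <- Rpower_sqrt by trivial. unfold Rpower. rewrite ln_exp. field. }
  rewrite <- exp_pow, exp_ln by trivial. reflexivity.
Qed.

(** This rational bound is sharp enough for Stirling: at $t=1/n$, multiplied by $n+1/2$, it equals
    exactly 1, so [log_stirling] decreases. *)
Lemma ln_1p_ge (t : R) : 0 <= t -> 2 * t / (2 + t) <= ln (1 + t).
Proof.
  intros ht. pose (F := fun t => ln (1 + t) - 2 * t / (2 + t)).
  enough (h : F 0 <= F t).
  { unfold F in h. rewrite Rplus_0_r, ln_1 in h. lra. }
  apply (derive_nonneg_le F (fun t => t ^ 2 / ((1 + t) * (2 + t) ^ 2))); trivial.
  - intros x hx. unfold F. auto_derive; [repeat split; lra|]. field. lra.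
  - intros x hx. apply Rdiv_le_0_compat; [apply pow2_ge_0|].
    apply Rmult_lt_0_compat; [lra|apply pow_lt; lra].
Qed.

Lemma log_stirling_step (n : nat) :
  (1 <= n)%nat ->
  0 <= log_stirling n - log_stirling (S n) <= 1 / 4 * (/ INR n - / INR (S n)).
Proof.
  intros hn. assert (h : 0 < INR n) by (apply lt_0_INR; lia).
  pose proof (INR_fact_pos n). pose proof (Rinv_0_lt_compat _ h) as hi.
  assert (e : log_stirling n - log_stirling (S n)
              = (INR n + 1 / 2) * ln (1 + / INR n) - 1).
  { unfold log_stirling. rewrite fact_simpl, mult_INR, S_INR, ln_mult by lra.
    replace (1 + / INR n) with ((INR n + 1) * / INR n) by (field; lra).
    rewrite (ln_mult _ (/ INR n)), ln_Rinv by lra. ring. }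
  rewrite e, S_INR. set (c := INR n) in *.
  pose proof (ln_1p_ge (/ c) ltac:(lra)) as h1.
  pose proof (ln_1p_le (/ c) ltac:(lra)) as h2.
  apply (Rmult_le_compat_l (c + 1 / 2)) in h1, h2; try lra.
  replace ((c + 1 / 2) * (2 * / c / (2 + / c))) with 1 in h1 by (field; lra).
  replace ((c + 1 / 2) * (/ c - (/ c) ^ 2 / (2 * (1 + / c))))
    with (1 + 1 / 4 * (/ c - / (c + 1))) in h2 by (field; lra).
  lra.
Qed.

(** The logarithm decreases, while [log_stirling n] minus $1/(4n)$ increases, which bounds it below.
    Exponentiating a finite limit also gives [0 < L]. *)
Lemma ex_lim_stirling : exists L, 0 < L /\ is_lim_seq stirling L.
Proof.
  assert (hlow : forall n, log_stirling 1 - 1 / 4 <= log_stirling (S n)).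
  { assert (h : forall n, log_stirling 1 - 1 / 4 <= log_stirling (S n) - 1 / 4 * / INR (S n)).
    { induction n as [|n IH]; [rewrite INR_1; lra|].
      pose proof (log_stirling_step (S n) ltac:(lia)). lra. }
    intros n. pose proof (h n).
    assert (0 < / INR (S n)) by (apply Rinv_0_lt_compat, lt_0_INR; lia). lra. }
  assert (hfin : ex_finite_lim_seq (fun n => log_stirling (S n))).
  { apply (ex_finite_lim_seq_decr _ (log_stirling 1 - 1 / 4)); trivial.
    intros n. pose proof (log_stirling_step (S n) ltac:(lia)). lra. }
  destruct hfin as [l hl]. exists (exp l). split; [apply exp_pos|].
  apply is_lim_seq_incr_1.
  apply (is_lim_seq_ext (fun n => exp (log_stirling (S n)))).
  { intros n. apply exp_log_stirling. lia. }
  apply (is_lim_seq_continuous exp); trivial.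
  apply derivable_continuous_pt, derivable_pt_exp.
Qed.

(** In the central binomial coefficient the powers and exponentials cancel, leaving a ratio of
    Stirling factors that tends to $L^2/L^4$ and so determines [L]. *)
Lemma wallis_stirling (n : nat) :
  (1 <= n)%nat ->
  INR (2 * n) * wallis (2 * n) ^ 2 = PI ^ 2 * (stirling (2 * n) ^ 2 / stirling n ^ 4).
Proof.
  intros hn. rewrite wallis_even. unfold stirling.
  assert (h : 0 < INR n) by (apply lt_0_INR; lia).
  pose proof (INR_fact_pos n). pose proof (INR_fact_pos (2 * n)).
  pose proof (exp_pos (INR n)).
  rewrite mult_INR. replace (INR 2) with 2 by (simpl; ring).
  replace (exp (2 * INR n)) with (exp (INR n) ^ 2)
    by (rewrite exp_pow; f_equal; simpl; ring).
  rewrite (Rpow_mult_distr 2 (INR n)), (pow_mult 2 2 n), (pow_mult (INR n) 2 n).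
  replace ((2 ^ 2) ^ n) with (4 ^ n) by (f_equal; ring).
  replace ((INR n ^ 2) ^ n) with ((INR n ^ n) ^ 2) by (rewrite <- !pow_mult; f_equal; lia).
  pose proof (pow_lt _ n h). pose proof (pow_lt 4 n ltac:(lra)).
  assert (q1 : sqrt (INR n) ^ 2 = INR n) by (apply pow2_sqrt; lra).
  assert (q2 : sqrt (2 * INR n) ^ 2 = 2 * INR n) by (apply pow2_sqrt; lra).
  unfold Rdiv. rewrite !Rpow_mult_distr, !pow_inv, !Rpow_mult_distr, q2.
  replace (sqrt (INR n) ^ 4) with ((sqrt (INR n) ^ 2) ^ 2) by ring. rewrite q1.
  field. repeat split; lra.
Qed.

Lemma stirling_lim : is_lim_seq stirling (sqrt (2 * PI)).
Proof.
  destruct ex_lim_stirling as [L [hL h]].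
  pose proof PI_RGT_0 as hpi.
  assert (h2 : is_lim_seq (fun n => stirling (2 * n)) L).
  { apply (is_lim_seq_subseq stirling L (fun n => (2 * n)%nat)); trivial.
    apply eventually_subseq. intros n. lia. }
  assert (hw : is_lim_seq (fun n => INR (2 * n) * wallis (2 * n) ^ 2) (PI / 2)).
  { assert (hw : is_lim_seq (fun n => INR n * wallis n ^ 2) (PI / 2)).
    { apply is_lim_seq_le_le with (fun n => PI / 2 * (1 - / INR (S n))) (fun _ => PI / 2).
      - intros n. destruct (wallis_sq_bounds n) as [h1 h3]. split; trivial.
        pose proof (lt_0_INR (S n) ltac:(lia)) as hn.
        replace (INR n) with (INR (S n) - 1) by (rewrite S_INR; ring).
        apply Rle_trans with ((INR (S n) * wallis n ^ 2) * (1 - / INR (S n))).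
        + apply Rmult_le_compat_r; trivial.
          assert (/ INR (S n) <= / 1); [|lra].
          apply Rinv_le_contravar; [lra|]. rewrite S_INR. pose proof (pos_INR n). lra.
        + right. field. lra.
      - replace (PI / 2) with (PI / 2 * (1 - 0)) at 1 by ring.
        apply (is_lim_seq_scal_l (fun n => 1 - / INR (S n)) (PI / 2) (1 - 0)).
        apply is_lim_seq_minus'; [apply is_lim_seq_const|].
        apply (is_lim_seq_incr_1 (fun n => / INR n)).
        apply (is_lim_seq_inv INR p_infty); [apply is_lim_seq_INR|discriminate].
      - apply is_lim_seq_const. }
    apply (is_lim_seq_subseq (fun n => INR n * wallis n ^ 2) _ (fun n => (2 * n)%nat)); trivial.
    apply eventually_subseq. intros n. lia. }
  assert (hs : is_lim_seq (fun n => INR (2 * n) * wallis (2 * n) ^ 2) (PI ^ 2 * (L ^ 2 / L ^ 4))).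
  { apply (is_lim_seq_ext_loc (fun n => PI ^ 2 * (stirling (2 * n) ^ 2 / stirling n ^ 4))).
    - exists 1%nat. intros n hn. symmetry. now apply wallis_stirling.
    - apply (is_lim_seq_scal_l _ (PI ^ 2) (L ^ 2 / L ^ 4)).
      apply is_lim_seq_div'.
      + simpl pow. repeat (apply is_lim_seq_mult'; trivial). apply is_lim_seq_const.
      + simpl pow. repeat (apply is_lim_seq_mult'; trivial). apply is_lim_seq_const.
      + apply pow_nonzero. lra. }
  (* Equating the limits gives $\pi/2=\pi^2L^2/L^4$, i.e. $L^2=2\pi$; positivity of [L] selects the
     root. *)
  apply is_lim_seq_unique in hw. apply is_lim_seq_unique in hs. rewrite hw in hs.
  injection hs as hs.
  replace (sqrt (2 * PI)) with L; trivial.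
  apply (f_equal (fun z => 2 * z * L ^ 2 / PI)) in hs.
  replace (2 * (PI / 2) * L ^ 2 / PI) with (L ^ 2) in hs by (field; lra).
  replace (2 * PI) with (L ^ 2) by (rewrite hs; field; lra).
  symmetry. apply sqrt_pow2. lra.
Qed.

(** * Decrease of the error between consecutive integers *)

(* The error in the variable [y = ln x], extending the formula valid for [nstar x = m + 1]. *)
Definition err (m : nat) (y : R) : R :=
  (y - INR (S m)) * exp y * INR (fact (S m)) / y ^ (S m + 1)
  + exp y / y * sum_f_R0 (fun k => INR (fact k) / y ^ k) m - li (exp y).

(** The derivative of $k!\,e^y/y^{k+1}$ is itself minus the next such term, so the sum
    telescopes. *)
Lemma is_derive_partial_sum (m : nat) (y : R) :
  0 < y ->
  is_derive (fun y => exp y / y * sum_f_R0 (fun k => INR (fact k) / y ^ k) m) y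
    (exp y / y - INR (fact (S m)) * exp y / y ^ (S m + 1)).
Proof.
  intros hy. induction m as [|m IH].
  - simpl. auto_derive; [lra|]. field. lra.
  - apply (is_derive_ext (fun y => exp y / y * sum_f_R0 (fun k => INR (fact k) / y ^ k) m
              + exp y / y * (INR (fact (S m)) / y ^ S m))).
    { intros t. now rewrite tech5, Rmult_plus_distr_l. }
    rewrite (fact_simpl (S m)), mult_INR.
    generalize dependent (INR (fact (S m))). intros f IH. eapply is_derive_eq.
    + apply is_derive_Rplus; [exact IH|].
      auto_derive; [|reflexivity]. pose proof (pow_lt y (S m) hy). simpl pow in *. split; lra.
    + change (match m with O => 1 | S _ => INR m + 1 end) with (INR (S m)).
      rewrite (S_INR (S m)), !Nat.add_1_r, <- !tech_pow_Rmult.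
      pose proof (pow_lt y m hy). field. lra.
Qed.

(** The derivative of [li (exp y)] cancels the leading $e^y/y$. The other end of the telescoped sum
    combines with the derivative of the interpolating term into a product vanishing at both
    integers. *)
Lemma is_derive_err (m : nat) (y : R) :
  0 < y ->
  is_derive (err m) y
    (- (INR (fact (S m)) * exp y / y ^ (S m + 2) * ((y - INR (S m)) * (INR (S m) + 1 - y)))).
Proof.
  intros hy. pose proof (is_derive_partial_sum m y hy) as hsum. unfold err.
  rewrite Nat.add_1_r in *. replace (S m + 2)%nat with (S (S (S m))) by lia.
  set (S0 := fun y => exp y / y * sum_f_R0 (fun k => INR (fact k) / y ^ k) m) in *.
  pose proof (pow_lt y (S (S m)) hy) as hp.
  pose proof (pow_lt y m hy).
  generalize dependent (INR (fact (S m))). intros f hsum. eapply is_derive_eq.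
  - apply (is_derive_Rplus (fun y => (y - INR (S m)) * exp y * f / y ^ S (S m) + S0 y)
             (fun y => - li (exp y))).
    + apply is_derive_Rplus; [|exact hsum].
      auto_derive; [simpl in hp; lra|reflexivity].
    + apply (@is_derive_opp R_AbsRing R_NormedModule).
      apply (is_derive_Rcomp li exp).
      * apply is_derive_li. now apply exp_gt_1.
      * auto_derive; trivial.
  - rewrite ln_exp. change (match m with O => 1 | S _ => INR m + 1 end) with (INR (S m)).
    change (opp (1 * exp y * / y)) with (- (1 * exp y * / y)).
    generalize (INR (S m)). intros c.
    rewrite <- !tech_pow_Rmult. field. lra.
Qed.

(** Continuity of the error at integers: at the right end the interpolating coefficient is 1 and its
    term is precisely the new summand; on the next interval that coefficient starts at 0. *)
Lemma err_join (m : nat) : err m (INR (S (S m))) = err (S m) (INR (S (S m))).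
Proof.
  unfold err. rewrite tech5.
  replace (INR (S (S m)) - INR (S m)) with 1 by (rewrite (S_INR (S m)); ring).
  pose proof (lt_0_INR (S (S m)) ltac:(lia)) as h.
  rewrite Rminus_diag, !Nat.add_1_r. set (c := INR (S (S m))) in *.
  rewrite <- !(tech_pow_Rmult c (S (S m))), <- !(tech_pow_Rmult c (S m)).
  pose proof (pow_lt c (S m) h) as hp. generalize dependent (c ^ S m).
  intros p hp. field. lra.
Qed.

(** At [u = c] every Taylor factor is 1, so [kfun] reduces to the partial sum of [li_star]. This
    links the error to the kernel integrals. *)
Lemma err_start_kfun (m : nat) :
  err m (INR (S m)) = kfun m (INR (S m)) (INR (S m)) - li (exp (INR (S m))).
Proof.
  unfold err. set (c := INR (S m)).
  assert (h : 0 < c) by (apply lt_0_INR; lia).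
  rewrite Rminus_diag. unfold Rdiv at 1. rewrite !Rmult_0_l, Rplus_0_l. f_equal.
  unfold kfun. rewrite scal_sum. apply sum_eq. intros k _.
  rewrite Rminus_diag, texp_0, <- tech_pow_Rmult. pose proof (pow_lt c k h). field. lra.
Qed.

(** The error at $\ln x = m+1$; the shift keeps the integer positive. *)
Definition err_int (m : nat) : R := err m (INR (S m)).

Lemma INR_S_lim : is_lim_seq (fun m => INR (S m)) p_infty.
Proof. apply (is_lim_seq_incr_1 INR), is_lim_seq_INR. Qed.

Lemma inv_INR_S_lim (a : R) : is_lim_seq (fun m => a / INR (S m)) 0.
Proof.
  replace 0 with (a * 0) by ring. apply (is_lim_seq_scal_l _ a 0).
  apply (is_lim_seq_inv _ p_infty); [exact INR_S_lim|discriminate].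
Qed.

Lemma inv_sqrt_INR_S_lim : is_lim_seq (fun m => / sqrt (INR (S m))) 0.
Proof.
  apply (is_lim_seq_inv _ p_infty); [|discriminate].
  apply (filterlim_comp _ _ _ (fun m => INR (S m)) sqrt _ (Rbar_locally p_infty));
    [exact INR_S_lim|apply filterlim_sqrt_p].
Qed.

Lemma err_int_lim : is_lim_seq err_int 0.
Proof.
  apply is_lim_seq_le_le with (fun _ => 0)
    (fun m => 512 * / sqrt (INR (S m)) + 16 / INR (S m)).
  - intros m. unfold err_int. rewrite err_start_kfun.
    pose proof (li_exp_INR_bounds m) as h. split; [lra|].
    assert (hc : 0 < INR (S m)) by (apply lt_0_INR; lia).
    assert (exp (- (INR (S m) / 4)) <= 4 * / INR (S m)).
    { rewrite exp_Ropp. replace (4 * / INR (S m)) with (/ (INR (S m) / 4)) by (field; lra).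
      apply Rinv_le_contravar; [lra|]. pose proof (exp_ineq1_le (INR (S m) / 4)). lra. }
    unfold Rdiv in *. lra.
  - apply is_lim_seq_const.
  - replace 0 with (512 * 0 + 0) by ring.
    apply is_lim_seq_plus'.
    + apply (is_lim_seq_scal_l _ 512 0), inv_sqrt_INR_S_lim.
    + apply (inv_INR_S_lim 16).
Qed.

Lemma err_decr (m : nat) (y z : R) :
  INR (S m) <= y -> y <= z -> z <= INR (S m) + 1 -> err m z <= err m y.
Proof.
  intros h1 h2 h3. assert (hc : 0 < INR (S m)) by (apply lt_0_INR; lia).
  apply (derive_nonpos_ge (err m) (fun y =>
    - (INR (fact (S m)) * exp y / y ^ (S m + 2) * ((y - INR (S m)) * (INR (S m) + 1 - y)))));
    trivial; intros t ht.
  - apply is_derive_err. lra.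
  - pose proof (INR_fact_pos (S m)) as hf. pose proof (exp_pos t) as he.
    pose proof (pow_lt t (S m + 2) ltac:(lra)) as hp.
    apply Ropp_le_cancel. rewrite Ropp_0, Ropp_involutive.
    apply Rmult_le_pos.
    + apply Rdiv_le_0_compat; [|exact hp]. apply Rmult_le_pos; lra.
    + apply Rmult_le_pos; lra.
Qed.

(** * Size of one step of the error and of $1/\sqrt n$ *)

Section StepBounds.
Variable m : nat.
Let n := S m.
Let c := INR n.

Let hc : 1 <= c.
Proof. unfold c, n. rewrite S_INR. pose proof (pos_INR m). lra. Qed.

(** Isolates the exact Stirling factor and the scale $\sqrt c/c^2=c^{-3/2}$; the remaining factor
    tends to 1 uniformly for [t] in $[0,1]$. *)
Lemma step_density_eq (t : R) :
  0 <= t ->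
  INR (fact n) * exp (c + t) / (c + t) ^ (n + 2)
  = stirling n * (sqrt c / c ^ 2) * (exp (t - c * ln (1 + t / c)) * / (1 + t / c) ^ 2).
Proof.
  intros ht. unfold stirling. fold c.
  assert (hv : 0 <= t / c) by (apply Rdiv_le_0_compat; lra).
  assert (hs : 0 < sqrt c) by (apply sqrt_lt_R0; lra).
  replace (c + t) with (c * (1 + t / c)) at 2 by (field; lra).
  rewrite exp_plus. unfold Rminus. rewrite exp_plus, exp_Ropp.
  assert (hq : exp (c * ln (1 + t / c)) = (1 + t / c) ^ n).
  { unfold c at 1. rewrite <- exp_pow, exp_ln by lra. reflexivity. }
  rewrite hq, Rpow_mult_distr, !pow_add.
  pose proof (pow_lt c n ltac:(lra)). pose proof (pow_lt (1 + t / c) n ltac:(lra)).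
  generalize dependent (c ^ n). generalize dependent ((1 + t / c) ^ n).
  intros q _ hq p hp. field. repeat split; lra.
Qed.

Lemma step_factor_bounds (t : R) :
  0 <= t <= 1 ->
  1 - 2 / c <= exp (t - c * ln (1 + t / c)) * / (1 + t / c) ^ 2 <= exp (1 / (2 * c)).
Proof.
  intros ht. assert (hv : 0 <= t / c) by (apply Rdiv_le_0_compat; lra).
  pose proof (ln_le_sub_1 (1 + t / c) ltac:(lra)) as h1.
  pose proof (ln_1p_ge (t / c) hv) as h2.
  apply (Rmult_le_compat_l c) in h1, h2; try lra.
  replace (c * (1 + t / c - 1)) with t in h1 by (field; lra).
  assert (hvc : t / c <= 1 / c) by (apply Rmult_le_compat_r; [left; apply Rinv_0_lt_compat|]; lra).
  assert (h3 : t - 1 / (2 * c) <= c * ln (1 + t / c)).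
  { eapply Rle_trans; [|exact h2].
    replace (c * (2 * (t / c) / (2 + t / c))) with (t - t ^ 2 / (2 * c + t)) by (field; lra).
    enough (t ^ 2 / (2 * c + t) <= 1 / (2 * c)) by lra.
    apply Rle_trans with (1 / (2 * c + t)).
    - apply Rmult_le_compat_r; [left; apply Rinv_0_lt_compat|]; nra.
    - apply Rmult_le_compat_l; [lra|]. apply Rinv_le_contravar; lra. }
  assert (hE1 : 1 <= exp (t - c * ln (1 + t / c))).
  { pose proof (exp_ineq1_le (t - c * ln (1 + t / c))). lra. }
  assert (hE2 : exp (t - c * ln (1 + t / c)) <= exp (1 / (2 * c))) by (apply exp_le_mono; lra).
  assert (hq : 0 < / (1 + t / c) ^ 2) by (apply Rinv_0_lt_compat, pow_lt; lra).
  assert (hq1 : / (1 + t / c) ^ 2 <= 1).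
  { rewrite <- Rinv_1 at 2. apply Rinv_le_contravar; nra. }
  split.
  - apply Rle_trans with (/ (1 + t / c) ^ 2); [|nra].
    apply Rle_trans with (1 - 2 * (t / c)); [lra|].
    set (v := t / c) in *. apply (Rmult_le_reg_r ((1 + v) ^ 2)); [apply pow_lt; lra|].
    rewrite Rinv_l by (apply pow_nonzero; lra).
    assert (0 <= v ^ 2) by nra. assert (0 <= v ^ 3) by (apply pow_le; lra).
    simpl in *; nra.
  - pose proof (exp_pos (1 / (2 * c))). nra.
Qed.

(** The sign [s], taken as 1 and -1, covers upper and lower bounds at once. The number $1/6$ is the
    increase of $\tau^2/2-\tau^3/3$ over the unit interval. *)
Lemma err_step_compare (A : R) (s : R) :
  (forall y, c <= y <= c + 1 -> s * (INR (fact n) * exp y / y ^ (n + 2)) <= s * A) ->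
  s * (err m c - err m (c + 1)) <= s * (A / 6).
Proof.
  intros hA.
  pose (F := fun y => s * err m y + s * A * ((y - c) ^ 2 / 2 - (y - c) ^ 3 / 3)).
  assert (hF : F c <= F (c + 1)).
  { apply (derive_nonneg_le F (fun y =>
      s * - (INR (fact n) * exp y / y ^ (n + 2) * ((y - c) * (c + 1 - y)))
      + s * A * ((y - c) * (c + 1 - y)))); [lra| |].
    - intros y hy. apply is_derive_Rplus.
      + apply (is_derive_scal (err m)). apply is_derive_err. lra.
      + auto_derive; trivial. field.
    - intros y hy. specialize (hA y hy).
      assert (0 <= (y - c) * (c + 1 - y)) by (apply Rmult_le_pos; lra).
      set (d := INR (fact n) * exp y / y ^ (n + 2)) in *.
      set (w := (y - c) * (c + 1 - y)) in *. nra. }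
  unfold F in hF. rewrite Rminus_diag in hF. replace (c + 1 - c) with 1 in hF by ring.
  lra.
Qed.

Lemma err_step_bounds :
  stirling n * (sqrt c / c ^ 2) * (1 - 2 / c) / 6 <= err_int m - err_int (S m)
  <= stirling n * (sqrt c / c ^ 2) * exp (1 / (2 * c)) / 6.
Proof.
  assert (hj : err_int (S m) = err m (c + 1)).
  { unfold err_int. rewrite <- err_join. unfold c, n. now rewrite (S_INR (S m)). }
  rewrite hj. change (err_int m) with (err m c).
  assert (hK : 0 < stirling n * (sqrt c / c ^ 2)).
  { pose proof (INR_fact_pos n). pose proof (exp_pos c).
    assert (0 < sqrt c) by (apply sqrt_lt_R0; lra). pose proof (pow_lt c n ltac:(lra)).
    unfold stirling. fold c. apply Rmult_lt_0_compat; apply Rdiv_lt_0_compat; trivial;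
      try apply Rmult_lt_0_compat; trivial; lra. }
  set (K := stirling n * (sqrt c / c ^ 2)) in *.
  assert (hd : forall y, c <= y <= c + 1 ->
     K * (1 - 2 / c) <= INR (fact n) * exp y / y ^ (n + 2) <= K * exp (1 / (2 * c))).
  { intros y hy. replace y with (c + (y - c)) by ring.
    rewrite step_density_eq by lra. fold K.
    pose proof (step_factor_bounds (y - c) ltac:(lra)) as h.
    split; apply Rmult_le_compat_l; lra. }
  split.
  - enough (-1 * (err m c - err m (c + 1)) <= -1 * (K * (1 - 2 / c) / 6)) by lra.
    apply err_step_compare. intros y hy. specialize (hd y hy). lra.
  - enough (1 * (err m c - err m (c + 1)) <= 1 * (K * exp (1 / (2 * c)) / 6)) by lra.
    apply err_step_compare. intros y hy. specialize (hd y hy). lra.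
Qed.

(** Rationalising gives $1/(\sqrt c\sqrt{c+1}(\sqrt c+\sqrt{c+1}))$, about $c^{-3/2}/2$: the same
    scale as the step of the error. *)
Lemma inv_sqrt_step_bounds :
  sqrt c / c ^ 2 * (1 - 2 / c) / 2 <= / sqrt c - / sqrt (c + 1) <= sqrt c / c ^ 2 / 2.
Proof.
  assert (hs : 0 < sqrt c) by (apply sqrt_lt_R0; lra).
  assert (hs2 : sqrt c * sqrt c = c) by (apply sqrt_sqrt; lra).
  assert (hr : 0 < sqrt (c + 1)) by (apply sqrt_lt_R0; lra).
  assert (hr2 : sqrt (c + 1) * sqrt (c + 1) = c + 1) by (apply sqrt_sqrt; lra).
  assert (hle : sqrt c <= sqrt (c + 1)) by (apply sqrt_le_1; lra).
  assert (e : / sqrt c - / sqrt (c + 1) = / (sqrt c * sqrt (c + 1) * (sqrt c + sqrt (c + 1)))).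
  { replace (/ (sqrt c * sqrt (c + 1) * (sqrt c + sqrt (c + 1))))
      with ((sqrt (c + 1) * sqrt (c + 1) - sqrt c * sqrt c)
              / (sqrt c * sqrt (c + 1) * (sqrt c + sqrt (c + 1)))).
    - field. lra.
    - rewrite hr2, hs2. unfold Rdiv. ring. }
  replace (sqrt c / c ^ 2) with (/ (sqrt c * c)).
  2:{ replace (c ^ 2) with (c * (sqrt c * sqrt c)) by (rewrite hs2; ring). field. lra. }
  rewrite e. split.
  - apply Rle_trans with (/ (2 * sqrt c * (c + 1))).
    + replace (/ (2 * sqrt c * (c + 1))) with (/ (2 * sqrt c) * / (c + 1)) by (field; lra).
      replace (/ (sqrt c * c) * (1 - 2 / c) / 2) with (/ (2 * sqrt c) * ((c - 2) / c ^ 2))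
        by (field; lra).
      apply Rmult_le_compat_l; [left; apply Rinv_0_lt_compat; lra|].
      apply Rle_div_l; [nra|]. apply (Rmult_le_reg_r (c + 1)); [lra|].
      replace (/ (c + 1) * c ^ 2 * (c + 1)) with (c ^ 2) by (field; lra). nra.
    + apply Rinv_le_contravar.
      * repeat apply Rmult_lt_0_compat; lra.
      * replace (2 * sqrt c * (c + 1)) with (2 * sqrt c * (sqrt (c + 1) * sqrt (c + 1)))
          by now rewrite hr2.
        set (a := sqrt c) in *. set (b := sqrt (c + 1)) in *.
        assert (0 <= a * b * (b - a)) by (apply Rmult_le_pos; [apply Rmult_le_pos|]; lra). lra.
  - replace (/ (sqrt c * c) / 2) with (/ (2 * (sqrt c * c))) by (field; lra).
    apply Rinv_le_contravar; [apply Rmult_lt_0_compat; nra|].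
    replace (2 * (sqrt c * c)) with (2 * (sqrt c * (sqrt c * sqrt c))) by now rewrite hs2.
    set (a := sqrt c) in *. set (b := sqrt (c + 1)) in *.
    assert (0 <= a * b * (b - a)) by (apply Rmult_le_pos; [apply Rmult_le_pos|]; lra).
    assert (0 <= a * a * (b - a)) by (apply Rmult_le_pos; [apply Rmult_le_pos|]; lra). lra.
Qed.

End StepBounds.

(** * Asymptotics of the error *)

Lemma is_lim_seq_eventually_lt (u : nat -> R) (l k : R) :
  is_lim_seq u l -> l < k -> eventually (fun n => u n < k).
Proof.
  intros h hlk. apply is_lim_seq_spec in h.
  assert (he : 0 < k - l) by lra. generalize (h (mkposreal _ he)).
  apply filter_imp. intros n hn. apply Rabs_def2 in hn. simpl in hn. lra.
Qed.

(** An increasing sequence stays below its limit; this replaces summing the steps from infinity. *)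
Lemma nonpos_of_eventually_incr_lim_0 (u : nat -> R) :
  is_lim_seq u 0 -> eventually (fun n => u n <= u (S n)) -> eventually (fun n => u n <= 0).
Proof.
  intros h [N hN]. exists N. intros n hn.
  apply (is_lim_seq_incr_compare (fun k => u (k + n)%nat) 0) with (n := 0%nat).
  - now apply (is_lim_seq_incr_n u n).
  - intros k. apply hN. lia.
Qed.

(** The coefficient for which the steps match: Stirling's limit is $3\kappa$, and
    $3\kappa/6=\kappa/2$ is the leading coefficient in the step of $\kappa/\sqrt n$. *)
Definition kappa : R := sqrt (2 * PI) / 3.

Lemma kappa_pos : 0 < kappa.
Proof.
  pose proof PI_RGT_0. apply Rdiv_lt_0_compat; [apply sqrt_lt_R0|]; lra.
Qed.

Lemma stirling_lim_S : is_lim_seq (fun m => stirling (S m)) (3 * kappa).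
Proof.
  replace (3 * kappa) with (sqrt (2 * PI)) by (unfold kappa; field).
  apply (is_lim_seq_incr_1 stirling), stirling_lim.
Qed.

Lemma err_int_upper (eta : R) :
  0 < eta -> eventually (fun m => err_int m <= (kappa + eta) / sqrt (INR (S m))).
Proof.
  intros he. pose proof kappa_pos as hk.
  pose (u := fun m => err_int m - (kappa + eta) * / sqrt (INR (S m))).
  assert (hev : eventually (fun m => u m <= 0)).
  { apply nonpos_of_eventually_incr_lim_0.
    - replace 0 with (0 - (kappa + eta) * 0) by ring.
      apply is_lim_seq_minus'; [apply err_int_lim|].
      apply (is_lim_seq_scal_l _ (kappa + eta) 0), inv_sqrt_INR_S_lim.
    (* In units of $\sqrt c/c^2$ this sequence bounds [u m - u (S m)] from above. Its limit is
       $-\eta/2$, so [u] eventually increases. *)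
    - assert (hl : is_lim_seq (fun m => stirling (S m) * exp (1 / 2 / INR (S m)) / 6
                       - (kappa + eta) * (1 - 2 / INR (S m)) / 2)
                     (3 * kappa * exp 0 / 6 - (kappa + eta) * (1 - 0) / 2)).
      { apply is_lim_seq_minus'.
        - apply is_lim_seq_div'; [|apply is_lim_seq_const|lra].
          apply is_lim_seq_mult'; [apply stirling_lim_S|].
          apply (is_lim_seq_continuous exp); [|apply inv_INR_S_lim].
          apply derivable_continuous_pt, derivable_pt_exp.
        - apply is_lim_seq_div'; [|apply is_lim_seq_const|lra].
          apply is_lim_seq_mult'; [apply is_lim_seq_const|].
          apply is_lim_seq_minus'; [apply is_lim_seq_const|apply inv_INR_S_lim]. }
      apply (is_lim_seq_eventually_lt _ _ 0) in hl; [|rewrite exp_0; lra].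
      revert hl. apply filter_imp. intros m hm. unfold u.
      destruct (err_step_bounds m) as [_ h1]. destruct (inv_sqrt_step_bounds m) as [h2 _].
      assert (hc : 0 < INR (S m)) by (apply lt_0_INR; lia).
      rewrite (S_INR (S m)).
      replace (1 / 2 / INR (S m)) with (1 / (2 * INR (S m))) in hm by (field; lra).
      set (c := INR (S m)) in *.
      assert (hd : 0 < sqrt c / c ^ 2).
      { apply Rdiv_lt_0_compat; [now apply sqrt_lt_R0|now apply pow_lt]. }
      set (d := sqrt c / c ^ 2) in *.
      apply (Rmult_le_compat_l (kappa + eta)) in h2; [|lra].
      assert (h3 : d * (stirling (S m) * exp (1 / (2 * c)) / 6
                        - (kappa + eta) * (1 - 2 / c) / 2) <= d * 0)
        by (apply Rmult_le_compat_l; lra).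
      lra. }
  revert hev. apply filter_imp. intros m. unfold u, Rdiv. lra.
Qed.

(** Mirror of the upper bound, with limit $-\eta/2$ again. The condition [eta <= kappa] keeps the
    multiplier [kappa - eta] nonnegative. *)
Lemma err_int_lower (eta : R) :
  0 < eta <= kappa -> eventually (fun m => (kappa - eta) / sqrt (INR (S m)) <= err_int m).
Proof.
  intros he. pose proof kappa_pos as hk.
  pose (u := fun m => (kappa - eta) * / sqrt (INR (S m)) - err_int m).
  assert (hev : eventually (fun m => u m <= 0)).
  { apply nonpos_of_eventually_incr_lim_0.
    - replace 0 with ((kappa - eta) * 0 - 0) by ring.
      apply is_lim_seq_minus'; [|apply err_int_lim].
      apply (is_lim_seq_scal_l _ (kappa - eta) 0), inv_sqrt_INR_S_lim.
    - assert (hl : is_lim_seq (fun m => (kappa - eta) / 2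
                       - stirling (S m) * (1 - 2 / INR (S m)) / 6)
                     ((kappa - eta) / 2 - 3 * kappa * (1 - 0) / 6)).
      { apply is_lim_seq_minus'; [apply is_lim_seq_const|].
        apply is_lim_seq_div'; [|apply is_lim_seq_const|lra].
        apply is_lim_seq_mult'; [apply stirling_lim_S|].
        apply is_lim_seq_minus'; [apply is_lim_seq_const|apply inv_INR_S_lim]. }
      apply (is_lim_seq_eventually_lt _ _ 0) in hl; [|lra].
      revert hl. apply filter_imp. intros m hm. unfold u.
      destruct (err_step_bounds m) as [h1 _]. destruct (inv_sqrt_step_bounds m) as [_ h2].
      assert (hc : 0 < INR (S m)) by (apply lt_0_INR; lia).
      rewrite (S_INR (S m)).
      set (c := INR (S m)) in *.
      assert (hd : 0 < sqrt c / c ^ 2).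
      { apply Rdiv_lt_0_compat; [now apply sqrt_lt_R0|now apply pow_lt]. }
      set (d := sqrt c / c ^ 2) in *.
      apply (Rmult_le_compat_l (kappa - eta)) in h2; [|lra].
      assert (h3 : d * ((kappa - eta) / 2 - stirling (S m) * (1 - 2 / c) / 6) <= d * 0)
        by (apply Rmult_le_compat_l; lra).
      lra. }
  revert hev. apply filter_imp. intros m. unfold u, Rdiv. lra.
Qed.

(** * From integers to real arguments *)

Lemma stieltjes_error_err (m : nat) (x : R) :
  0 < x -> INR (S m) <= ln x < INR (S m) + 1 -> stieltjes_error x = err m (ln x).
Proof.
  intros hx h. unfold stieltjes_error, li_star, err.
  assert (hn : nstar x = S m).
  { unfold nstar. rewrite (Zfloor_eq (Z.of_nat (S m))).
    - apply Nat2Z.id.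
    - now rewrite <- INR_IZR_INZ. }
  rewrite hn, exp_ln by trivial. now replace (S m - 1)%nat with m by lia.
Qed.

Lemma main_term_kappa (x : R) : 0 < ln x -> main_term x = kappa / sqrt (ln x).
Proof.
  intros h. unfold main_term, kappa. pose proof PI_RGT_0.
  rewrite sqrt_div_alt by trivial. pose proof (sqrt_lt_R0 _ h). field. lra.
Qed.

Lemma nat_floor_large (N : nat) (y : R) :
  INR (S N) <= y -> exists m, (N <= m)%nat /\ INR (S m) <= y < INR (S m) + 1.
Proof.
  intros hy. destruct (Zfloor_bound y) as [h1 h2].
  assert (hz : (Z.of_nat (S N) <= Zfloor y)%Z).
  { apply Zfloor_lub. now rewrite <- INR_IZR_INZ. }
  exists (Nat.pred (Z.to_nat (Zfloor y))). split; [lia|].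
  replace (S (Nat.pred (Z.to_nat (Zfloor y)))) with (Z.to_nat (Zfloor y)) by lia.
  rewrite INR_IZR_INZ, Z2Nat.id by lia. lra.
Qed.

(** Between consecutive integers the decreasing error is trapped by its end values, and replacing
    $\sqrt n$ or $\sqrt{n+1}$ by $\sqrt y$ costs only a relative $1/n$. *)
Lemma stieltjes_error_little_o :
  little_o_infty (fun x => stieltjes_error x - main_term x) (fun x => 1 / sqrt (ln x)).
Proof.
  intros eps. pose proof (cond_pos eps) as heps. pose proof kappa_pos as hk.
  (* Half of [eps] goes to the integer asymptotics; the other half absorbs [(kappa + eta) / c], the
     cost of moving to real [y]. *)
  set (eta := Rmin (eps / 2) kappa).
  assert (heta : 0 < eta <= kappa) by (split; [apply Rmin_glb_lt; lra|apply Rmin_r]).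
  assert (heta2 : eta <= eps / 2) by apply Rmin_l.
  assert (hsm : eventually (fun m => (kappa + eta) / INR (S m) < eps / 2)).
  { eapply is_lim_seq_eventually_lt; [apply inv_INR_S_lim|]. lra. }
  destruct (filter_and _ _ (err_int_upper eta (proj1 heta))
             (filter_and _ _ (err_int_lower eta heta) hsm)) as [N hN].
  exists (exp (INR (S N))). intros x hx.
  assert (hx0 : 0 < x) by (pose proof (exp_pos (INR (S N))); lra).
  assert (hy : INR (S N) <= ln x).
  { rewrite <- (ln_exp (INR (S N))). apply ln_le; [apply exp_pos|lra]. }
  destruct (nat_floor_large N (ln x) hy) as [m [hm hmy]].
  (* The upper bound is taken at the left integer and the lower bound at the right one, hence the
     index [S m]. *)
  destruct (hN m hm) as [hup [_ hsmall]]. destruct (hN (S m) ltac:(lia)) as [_ [hlow _]].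
  assert (hc : 0 < INR (S m)) by (apply lt_0_INR; lia).
  rewrite main_term_kappa, (stieltjes_error_err m x hx0 hmy) by lra.
  set (y := ln x) in *.
  pose proof (err_decr m (INR (S m)) y ltac:(lra) ltac:(lra) ltac:(lra)) as h1.
  pose proof (err_decr m y (INR (S m) + 1) ltac:(lra) ltac:(lra) ltac:(lra)) as h2.
  rewrite <- (S_INR (S m)), err_join in h2.
  fold (err_int m) in h1. fold (err_int (S m)) in h2.
  rewrite (S_INR (S m)) in hlow. set (c := INR (S m)) in *.
  assert (hs : 0 < sqrt y) by (apply sqrt_lt_R0; lra).
  change (Rabs (err m y - kappa / sqrt y) <= eps * Rabs (1 / sqrt y)).
  rewrite (Rabs_pos_eq (1 / sqrt y)) by (apply Rdiv_le_0_compat; lra).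
  assert (hR : sqrt y * sqrt y = y) by (apply sqrt_sqrt; lra).
  assert (hR2 : sqrt c * sqrt c = c) by (apply sqrt_sqrt; lra).
  assert (hR3 : sqrt (c + 1) * sqrt (c + 1) = c + 1) by (apply sqrt_sqrt; lra).
  assert (hsc : 0 < sqrt c) by (apply sqrt_lt_R0; lra).
  assert (hle1 : sqrt c <= sqrt y) by (apply sqrt_le_1; lra).
  assert (hle2 : sqrt y <= sqrt (c + 1)) by (apply sqrt_le_1; lra).
  (* After clearing denominators: $\sqrt c\sqrt y\le y\le c+1$. *)
  assert (hA : / sqrt c <= (1 + 1 / c) * / sqrt y).
  { apply (Rmult_le_reg_r (c * sqrt y)); [apply Rmult_lt_0_compat; lra|].
    replace (/ sqrt c * (c * sqrt y)) with (sqrt c * sqrt y)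
      by (transitivity (/ sqrt c * (sqrt c * sqrt c * sqrt y)); [field; lra|now rewrite hR2]).
    replace ((1 + 1 / c) * / sqrt y * (c * sqrt y)) with (c + 1) by (field; lra).
    apply Rle_trans with (sqrt y * sqrt y); [apply Rmult_le_compat_r|]; lra. }
  (* After clearing denominators: $(1-1/c)(c+1)=c-1/c\le y$. *)
  assert (hB : (1 - 1 / c) * / sqrt y <= / sqrt (c + 1)).
  { apply (Rmult_le_reg_r (sqrt y * sqrt (c + 1))); [apply Rmult_lt_0_compat; lra|].
    replace (/ sqrt (c + 1) * (sqrt y * sqrt (c + 1))) with (sqrt y) by (field; lra).
    replace ((1 - 1 / c) * / sqrt y * (sqrt y * sqrt (c + 1)))
      with ((1 - 1 / c) * sqrt (c + 1)) by (field; lra).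
    apply (Rmult_le_reg_r (sqrt (c + 1))); [lra|].
    rewrite Rmult_assoc, hR3.
    apply Rle_trans with (sqrt y * sqrt y); [|apply Rmult_le_compat_l; lra].
    assert (0 < 1 / c) by (apply Rdiv_lt_0_compat; lra).
    replace ((1 - 1 / c) * (c + 1)) with (c - 1 / c) by (field; lra). lra. }
  assert (hi : 0 < / sqrt y) by now apply Rinv_0_lt_compat.
  apply (Rmult_le_compat_l (kappa + eta)) in hA; [|lra].
  apply (Rmult_le_compat_l (kappa - eta)) in hB; [|lra].
  unfold Rdiv in *. set (z := / sqrt y) in *.
  assert (0 < / c) by now apply Rinv_0_lt_compat.
  assert (h5 : (eta + (kappa + eta) * / c) * z <= eps * z) by (apply Rmult_le_compat_r; lra).
  assert (h6 : 0 <= eta * / c * z) by (apply Rmult_le_pos; [apply Rmult_le_pos|]; lra).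
  apply Rabs_le. split; lra.
Qed.

Theorem mainTheorem1 :
  exists r1 r2 : R -> R,
    little_o_infty r1 (fun x => 1 / sqrt (ln x)) /\
    little_o_infty r2 (fun x => 1 / sqrt (ln x)) /\
    (forall x : R, exp 1 <= x <= exp 1000 ->
       main_term x + r1 x <= stieltjes_error x <= main_term x + r2 x) /\
    (forall x : R, exp 1000 < x ->
       main_term x + r1 x - 0.0000035462 <= stieltjes_error x
         <= main_term x + r2 x + 0.0000021511).
Proof.
  exists (fun x => stieltjes_error x - main_term x), (fun x => stieltjes_error x - main_term x).
  split; [exact stieltjes_error_little_o|]. split; [exact stieltjes_error_little_o|].
  split; intros x _; lra.
Qed.
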